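(* Let $q\ge2$ and $d\ge 2$ be arbitrary integers. Then the graph $\mathrm{DL}_d(q)$ is quasi-isometric with $\mathrm{DL}_d(q^s)$ (for $s\ge 1$), and when $s$ is sufficiently large, $\mathrm{DL}_d(q^s)$ is a Cayley graph of the group $\Gamma_d(\mathbb F_{q^s})$ defined in the context.
   Context: For an integer $q\ge 2$, $\mathbb T_q$ is the homogeneous tree in which every vertex has $q+1$ neighbours, with graph metric $d(\cdot,\cdot)$, a fixed origin $o$ and a fixed end $\omega$ (an end is a class of one-sided infinite geodesic rays, two rays being equivalent if their symmetric difference is finite). Let $x\curlywedge y$ be the maximal common ancestor of $x,y$, i.e. the first common vertex of the geodesic rays from $x$ and from $y$ that represent $\omega$. The Busemann function is $\mathfrak h(x)=d(x,x\curlywedge o)-d(o,x\curlywedge o)$. The graph $\mathrm{DL}_d(q)=\mathrm{DL}(q,\dots,q)$ ($d$ times) has vertex set $\{x_1\cdots x_d\in(\mathbb T_q)^d:\ \mathfrak h(x_1)+\dots+\mathfrak h(x_d)=0\}$, and $x_1\cdots x_d$, $y_1\cdots y_d$ are neighbours iff there are $i\ne j$ such that $x_i\sim y_i$, $x_j\sim y_j$ in $\mathbb T_q$ and $x_k=y_k$ for all $k\ne i,j$. For an integer $Q\ge2$ with factorization $Q=P_1\cdots P_r$ into prime powers (powers of pairwise distinct primes) satisfying $P_\iota\ge d-1$ for all $\iota$, let $\mathbb F_{P_\iota}$ be the field of order $P_\iota$ and $\mathbb F_Q:=\mathbb F_{P_1}\times\dots\times\mathbb F_{P_r}$ with coordinatewise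 operations. Choose for each $\iota$ distinct elements $\ell_{\iota,1},\dots,\ell_{\iota,d-1}\in\mathbb F_{P_\iota}$, set $\ell_j=(\ell_{1,j},\dots,\ell_{r,j})\in\mathbb F_Q$, and let $\mathcal R_d(\mathbb F_Q)=\mathbb F_Q[(t+\ell_1)^{-1},\dots,(t+\ell_{d-1})^{-1},t]$ (the localization of $\mathbb F_Q[t]$ at $t+\ell_1,\dots,t+\ell_{d-1}$). Then $\Gamma_d(\mathbb F_Q)$ is the group of all matrices $\begin{pmatrix}(t+\ell_1)^{k_1}\cdots(t+\ell_{d-1})^{k_{d-1}}&P\\0&1\end{pmatrix}$ with $k_1,\dots,k_{d-1}\in\mathbb Z$, $P\in\mathcal R_d(\mathbb F_Q)$. A quasi-isometry between metric spaces $(X_1,d_1)$ and $(X_2,d_2)$ is a map $\phi:X_1\to X_2$ for which there are $A>0$, $B\ge0$ with $A^{-1}d_2(\phi x_1,\phi y_1)-B\le d_1(x_1,y_1)\le A\,d_2(\phi x_1,\phi y_1)+B$ for all $x_1,y_1\in X_1$ and $d_2(x_2,\phi X_1)\le B$ for all $x_2\in X_2$. Graphs carry the graph metric. A Cayley graph of a group $\Gamma$ is taken with respect to some finite generating set $S=S^{-1}$; it has vertex set $\Gamma$ and edges $[x,y]$ whenever $x^{-1}y\in S$. *)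

(* Defs.v *)
From HB Require Import structures.
From mathcomp Require Import all_boot all_order all_algebra.
From mathcomp Require Import boolp classical_sets functions cardinality.
From mathcomp Require Import reals constructive_ereal ereal.

Set Implicit Arguments.
Unset Strict Implicit.
Unset Printing Implicit Defensive.

Import Order.TTheory GRing.Theory Num.Theory.
Local Open Scope classical_set_scope.
Local Open Scope card_scope.
Local Open Scope ring_scope.

Structure graph := Graph { vertex :> choiceType; adj : rel vertex }.
Arguments adj {g}.

Definition walk (G : graph) (x y : G) (n : nat) : Prop :=
  exists p : seq G, [/\ path adj x p, last x p = y & size p = n].

Definition connected_graph (G : graph) : Prop :=
  forall x y : G, exists n, walk x y n.

(* Graph metric; the value 0 for x, y in different components is a dummy. *)
Definition gdist (G : graph) (x y : G) : nat :=
  if pselect (exists n, `[< walk x y n >]) is left h then ex_minn h else 0.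

(* Graph metric as an extended real, +oo between different components. *)
Definition edist (R : realType) (G : graph) (x y : G) : \bar R :=
  if `[< exists n, walk x y n >] then ((gdist x y)%:R)%:E else +oo%E.

Definition graph_iso (G H : graph) : Prop :=
  exists f : G -> H, bijective f /\ forall x y, adj (f x) (f y) = adj x y.

Definition quasi_isometric (R : realType) (X1 X2 : Type)
    (d1 : X1 -> X1 -> \bar R) (d2 : X2 -> X2 -> \bar R) : Prop :=
  exists (phi : X1 -> X2) (A B : R), [/\ 0 < A, 0 <= B,
    forall x y, ((A^-1)%:E * d2 (phi x) (phi y) - B%:E <= d1 x y)%E
             /\ (d1 x y <= A%:E * d2 (phi x) (phi y) + B%:E)%E
  & forall x2, (ereal_inf [set d2 x2 (phi x1) | x1 in [set: X1]] <= B%:E)%E].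

Definition is_tree (G : graph) : Prop :=
  [/\ symmetric (@adj G), irreflexive (@adj G), connected_graph G
    & forall c : seq G, ucycle adj c -> (size c <= 2)%N].

Definition is_ray (G : graph) (r : nat -> G) : Prop :=
  forall m n : nat, gdist (r m) (r n) = `|m%:Z - n%:Z|%N.

Definition ray_equiv (G : graph) (r r' : nat -> G) : Prop :=
  finite_set (range r `+` range r').

Definition is_end (G : graph) (w : set (nat -> G)) : Prop :=
  exists2 r, is_ray r & w = [set r' | is_ray r' /\ ray_equiv r r'].

(* A homogeneous tree of degree q + 1 with a chosen origin and end; any two are
   isomorphic as trees with origin and end. *)
Structure hom_tree (q : nat) := HomTree {
  tree_graph :> graph;
  origin : tree_graph;
  tree_end : set (nat -> tree_graph);
  hom_treeP : is_tree tree_graph;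
  hom_tree_degree : forall x : tree_graph, [set y | adj x y] #= `I_q.+1;
  tree_endP : is_end tree_end
}.

Section Busemann.
Variables (q : nat) (T : hom_tree q).
Implicit Types x y v : T.

(* v is the first common vertex of the rays from x and from y that represent
   the end. *)
Definition is_confluent x y v : Prop :=
  exists (r r' : nat -> T) (m n : nat),
    [/\ tree_end r, tree_end r', r 0%N = x & r' 0%N = y] /\
    [/\ r m = v, r' n = v, forall i, (i < m)%N -> ~ range r' (r i)
      & forall j, (j < n)%N -> ~ range r (r' j)].

Definition confluent x y : T := xget x (is_confluent x y).

Definition busemann x : int :=
  (gdist x (confluent x (origin T)))%:Z
  - (gdist (origin T) (confluent x (origin T)))%:Z.

End Busemann.

Definition DL (d q : nat) (T : hom_tree q) : graph :=
  @Graph {x : {ffun 'I_d -> T} | \sum_(i < d) busemann (x i) == 0}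
    (fun x y => [exists i, exists j,
       [&& i != j, adj (val x i) (val y i), adj (val x j) (val y j)
         & [forall k, (k != i) && (k != j) ==> (val x k == val y k)]]]).

Definition cayley_graph (G : groupType) (S : seq G) : graph :=
  @Graph G (fun x y => (x^-1 * y)%g \in S).

Definition generates (G : groupType) (S : seq G) : Prop :=
  forall x : G, exists2 w : seq G, {subset w <= S} & x = (\prod_(y <- w) y)%g.

Definition is_cayley_graph_of (G : groupType) (X : graph) : Prop :=
  exists S : seq G, [/\ forall x, (x^-1)%g \in S = (x \in S), generates S
                      & graph_iso X (cayley_graph S)].

Definition prime_power_factorization (Q r : nat) (P : 'I_r -> nat) : Prop :=
  Q = (\prod_(i < r) P i)%N /\
  exists p e : 'I_r -> nat, injective p /\
    forall i, [/\ prime (p i), (0 < e i)%N & P i = (p i ^ e i)%N].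

(* The product F_0 x ... x F_r with coordinatewise operations; it has at least
   one factor, so that it is a nontrivial ring. *)
Section ProdField.
Variables (r : nat) (F : 'I_r.+1 -> finFieldType).

Definition prod_field : Type := {dffun forall i : 'I_r.+1, F i}.
HB.instance Definition _ := Choice.on prod_field.

Definition pf_zero : prod_field := [ffun i => 0 : F i].
Definition pf_one : prod_field := [ffun i => 1 : F i].
Definition pf_opp (x : prod_field) : prod_field := [ffun i => - x i : F i].
Definition pf_add (x y : prod_field) : prod_field := [ffun i => x i + y i : F i].
Definition pf_mul (x y : prod_field) : prod_field := [ffun i => x i * y i : F i].

Lemma pf_addA : associative pf_add.
Proof. by move=> x y z; apply/ffunP => i; rewrite !ffunE addrA. Qed.
Lemma pf_addC : commutative pf_add.
Proof. by move=> x y; apply/ffunP => i; rewrite !ffunE addrC. Qed.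
Lemma pf_add0 : left_id pf_zero pf_add.
Proof. by move=> x; apply/ffunP => i; rewrite !ffunE add0r. Qed.
Lemma pf_addN : left_inverse pf_zero pf_opp pf_add.
Proof. by move=> x; apply/ffunP => i; rewrite !ffunE addNr. Qed.

HB.instance Definition _ :=
  GRing.isZmodule.Build prod_field pf_addA pf_addC pf_add0 pf_addN.

Lemma pf_mulA : associative pf_mul.
Proof. by move=> x y z; apply/ffunP => i; rewrite !ffunE mulrA. Qed.
Lemma pf_mulC : commutative pf_mul.
Proof. by move=> x y; apply/ffunP => i; rewrite !ffunE mulrC. Qed.
Lemma pf_mul1 : left_id pf_one pf_mul.
Proof. by move=> x; apply/ffunP => i; rewrite !ffunE mul1r. Qed.
Lemma pf_mulD : left_distributive pf_mul pf_add.
Proof. by move=> x y z; apply/ffunP => i; rewrite !ffunE mulrDl. Qed.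
Lemma pf_one_neq0 : pf_one != 0.
Proof.
by apply/eqP => /ffunP /(_ ord0) /eqP; rewrite !ffunE oner_eq0.
Qed.

HB.instance Definition _ := GRing.Zmodule_isComNzRing.Build prod_field
  pf_mulA pf_mulC pf_mul1 pf_mulD pf_one_neq0.

End ProdField.

(* A localization of B at the multiplicative monoid generated by the s j. *)
Structure localization (B : comNzRingType) (n : nat) (s : 'I_n -> B) :=
  Localization {
  loc_ring :> comUnitRingType;
  loc_map : {rmorphism B -> loc_ring};
  loc_unit : forall j, loc_map (s j) \is a GRing.unit;
  loc_frac : forall x : loc_ring, exists (b : B) (k : 'I_n -> nat),
    x = loc_map b / \prod_(j < n) loc_map (s j) ^+ k j;
  loc_ker : forall b : B, loc_map b = 0 ->
    exists k : 'I_n -> nat, b * \prod_(j < n) s j ^+ k j = 0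
}.

Section Gamma.
Variables (r : nat) (F : 'I_r.+1 -> finFieldType) (n : nat).

(* ell j = (l 0 j, ..., l r j) *)
Definition ell (l : forall i, 'I_n -> F i) (j : 'I_n) : prod_field F :=
  [ffun i => l i j : F i].

Definition t_plus_ell (l : forall i, 'I_n -> F i) (j : 'I_n)
  : {poly prod_field F} := 'X + (ell l j)%:P.

Variables (l : forall i, 'I_n -> F i) (R : localization (t_plus_ell l)).

Definition affine_mx (a b : R) : 'M[R]_2 :=
  \matrix_(i < 2, j < 2) nth 0 (nth [::] [:: [:: a; b]; [:: 0; 1]] i) j.

Definition unit_monomial (k : 'I_n -> int) : R :=
  \prod_(j < n) loc_map R (t_plus_ell l j) ^ k j.

Definition is_Gamma_mx (M : 'M[R]_2) : Prop :=
  exists (k : 'I_n -> int) (P : R), M = affine_mx (unit_monomial k) P.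

Definition Gamma : Type := {M : 'M[R]_2 | `[< is_Gamma_mx M >]}.
HB.instance Definition _ := Choice.on Gamma.

Lemma affine_mxM a b a' b' :
  affine_mx a b * affine_mx a' b' = affine_mx (a * a') (a * b' + b).
Proof.
apply/matrixP => i j; rewrite !mxE !big_ord_recl big_ord0 !mxE /= addr0.
by case: i j => [[|[|//]] ?] [[|[|//]] ?] /=;
  rewrite ?(mulr0, mul0r, addr0, add0r, mulr1, mul1r).
Qed.

Lemma affine_mx1 : affine_mx 1 0 = 1.
Proof.
apply/matrixP => i j; rewrite !mxE.
by case: i j => [[|[|//]] ?] [[|[|//]] ?].
Qed.

Lemma unit_monomialM k k' :
  unit_monomial k * unit_monomial k' = unit_monomial (fun j => k j + k' j).
Proof.
rewrite -big_split; apply: eq_bigr => j _ /=.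
by rewrite exprzDr ?loc_unit.
Qed.

Lemma unit_monomial0 : unit_monomial (fun=> 0) = 1.
Proof. by rewrite /unit_monomial big1. Qed.

Lemma is_Gamma_mxM (x y : 'M[R]_2) :
  is_Gamma_mx x -> is_Gamma_mx y -> is_Gamma_mx (x * y).
Proof.
move=> [k [P ->]] [k' [P' ->]].
by rewrite affine_mxM unit_monomialM; do 2 eexists.
Qed.

Lemma Gamma_mulP (x y : Gamma) : `[< is_Gamma_mx (val x * val y) >].
Proof.
have /asboolP Gx := svalP x; have /asboolP Gy := svalP y.
exact/asboolP/is_Gamma_mxM.
Qed.

Lemma is_Gamma_mxV (x : 'M[R]_2) : is_Gamma_mx x ->
  x \is a GRing.unit /\ is_Gamma_mx x^-1.
Proof.
case=> k [P ->]; set M := affine_mx _ _; set u := unit_monomial (- k).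
have uK : u * unit_monomial k = 1.
  rewrite unit_monomialM -unit_monomial0; congr unit_monomial.
  by apply/funext => j; rewrite addNr.
have NM : affine_mx u (- (u * P)) * M = 1.
  by rewrite affine_mxM uK subrr affine_mx1.
have [_ Mu] := mulmx1_unit NM.
split=> //; exists (- k), (- (u * P)).
by rewrite -[LHS]mul1r -NM mulrK.
Qed.

Lemma Gamma_invP (x : Gamma) : `[< is_Gamma_mx (val x)^-1 >].
Proof.
by have /asboolP /is_Gamma_mxV [_ Vx] := svalP x; apply/asboolP.
Qed.

Lemma Gamma_oneP : `[< is_Gamma_mx 1 >].
Proof.
by apply/asboolP; exists (fun=> 0), 0; rewrite unit_monomial0 affine_mx1.
Qed.

Definition Gamma_mul (x y : Gamma) : Gamma :=
  exist (fun M => `[< is_Gamma_mx M >]) _ (Gamma_mulP x y).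
Definition Gamma_inv (x : Gamma) : Gamma :=
  exist (fun M => `[< is_Gamma_mx M >]) _ (Gamma_invP x).
Definition Gamma_one : Gamma :=
  exist (fun M => `[< is_Gamma_mx M >]) _ Gamma_oneP.

Lemma Gamma_unit (x : Gamma) : val x \is a GRing.unit.
Proof. by have /asboolP /is_Gamma_mxV [] := svalP x. Qed.

Lemma Gamma_mulA : associative Gamma_mul.
Proof. by move=> x y z; apply: val_inj; rewrite /= mulrA. Qed.
Lemma Gamma_mul1 : left_id Gamma_one Gamma_mul.
Proof. by move=> x; apply: val_inj; rewrite /= mul1r. Qed.
Lemma Gamma_1mul : right_id Gamma_one Gamma_mul.
Proof. by move=> x; apply: val_inj; rewrite /= mulr1. Qed.
Lemma Gamma_mulV : left_inverse Gamma_one Gamma_inv Gamma_mul.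
Proof. by move=> x; apply: val_inj; rewrite /= mulVr ?Gamma_unit. Qed.
Lemma Gamma_Vmul : right_inverse Gamma_one Gamma_inv Gamma_mul.
Proof. by move=> x; apply: val_inj; rewrite /= mulrV ?Gamma_unit. Qed.

HB.instance Definition _ := isGroup.Build Gamma
  Gamma_mulA Gamma_mul1 Gamma_1mul Gamma_mulV Gamma_Vmul.

End Gamma.

(* Main.v *)
Require Import Defs.
From mathcomp Require Import all_boot all_order all_algebra perm.
From mathcomp Require Import reals.
From mathcomp Require Import boolp classical_sets functions cardinality.
From mathcomp Require Import constructive_ereal ereal.
From mathcomp Require Import ring zify.

Set Implicit Arguments.
Unset Strict Implicit.
Unset Printing Implicit Defensive.

Import Order.TTheory GRing.Theory Num.Theory.

(** A homogeneous tree with a chosen end is determined, up to an isomorphism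
    respecting the Busemann function, by its parent map (one step towards the
    end): every vertex has [q] children and any two vertices have a common
    ancestor ([hom_tree_horotree], [horotree_unique]).  Both halves of the
    theorem compare the given trees with explicit ones through this uniqueness.

    In DL_d a neighbour is obtained by letting one coordinate go up and another
    one go down.  If all coordinates of two vertices have common ancestors at
    most [N] generations away, the vertices are joined by a walk whose length is
    bounded in terms of [d] and [N]: one coordinate is set aside to compensate
    the height while the others are corrected one by one, and is corrected last
    ([DL_cousins_reach]).  In particular DL_d is connected.

    For the quasi-isometry, keeping only the levels divisible by [s] turns the tree
    of [q] into that of [q ^ s], with [s]-fold parents as parents
    ([sublevel_horotree]).  Replacing each coordinate by its nearest kept
    ancestor lowers the sum of the heights by at most [d] (in units of [s]),
    which one coordinate makes up for by descending.  This map and the inclusion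
    of the kept levels move coordinates by bounded amounts and are inverse to
    each other up to bounded amounts ([DL_quasi_isometric]).

    For the Cayley graph, the ring of the group has [d] places: the zeros of the
    [t + l_j], where elements without pole are small, and infinity, where
    elements of negative degree are small.  The balls of each place, ordered by
    inclusion, form the tree of [Q], because the constants represent a ball
    modulo the next smaller one ([place_tree]).  An affine map with linear part
    [prod_j (t + l_j) ^ k_j] shifts the levels of the balls by [k_j] at the zero
    of [t + l_j] and by [- sum_j k_j] at infinity, so the group acts on the
    product at total height zero.  The action on vertices is simply transitive:
    by partial fractions principal parts can be prescribed independently at all
    places ([partial_fractions]), and an element that is small everywhere is a
    polynomial of negative degree, hence zero ([places_trivial]).  A connected,
    locally finite graph with such an action is a Cayley graph ([DL_cayley]).
    Finally every factor [P i] of [q ^ s] is divisible by the [s]-th power of its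
    prime and so exceeds [s] ([prime_power_factor_large]). *)

(** * Walks and the graph metric *)

Section Walks.
Variable G : graph.
Implicit Types (x y z : G) (m n : nat).

Lemma walk0 x : walk x x 0.
Proof. by exists [::]. Qed.

Lemma walk1 x y : adj x y -> walk x y 1.
Proof. by move=> xy; exists [:: y]; rewrite /= xy. Qed.

Lemma walk_trans x y z m n : walk x y m -> walk y z n -> walk x z (m + n).
Proof.
move=> [p [xp <- <-]] [p' [yp' <- <-]]; exists (p ++ p').
by rewrite cat_path xp yp' last_cat size_cat.
Qed.

Lemma walkS x z n : walk x z n.+1 -> exists2 y, adj x y & walk y z n.
Proof.
move=> [[|y p] [//= /andP[xy yp] <- [<-]]].
by exists y => //; exists p.
Qed.

Lemma gdist_le x y n : walk x y n -> (gdist x y <= n)%N.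
Proof.
move=> w; rewrite /gdist; case: pselect => // h.
by case: ex_minnP => m _; apply; apply/asboolP.
Qed.

Lemma gdistP x y n : walk x y n -> walk x y (gdist x y).
Proof.
move=> w; rewrite /gdist; case: pselect => [h|[]].
  by case: ex_minnP => m /asboolP.
by exists n; apply/asboolP.
Qed.

Hypothesis adjC : symmetric (@adj G).

Lemma walkC x y n : walk x y n -> walk y x n.
Proof.
move=> [p [xp <- <-]]; elim: p x xp => [|y' p IHp] x /=; first by exists [::].
case/andP=> xy /IHp w; rewrite -addn1; apply: walk_trans w _.
by apply: walk1; rewrite adjC.
Qed.

End Walks.

(** * Distances in a tree *)

Section Tree.
Variable G : graph.
Hypothesis treeG : is_tree G.
Implicit Types (x y z : G) (m n : nat).

Let adjC : symmetric (@adj G). Proof. by case: treeG. Qed.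
Let adj_irr : irreflexive (@adj G). Proof. by case: treeG. Qed.

Lemma tree_gdistP x y : walk x y (gdist x y).
Proof. by case: treeG => _ _ + _ => /(_ x y) [n]; apply: gdistP. Qed.

Lemma tree_gdistC x y : gdist x y = gdist y x.
Proof.
by apply/eqP; rewrite eqn_leq !gdist_le //; apply/walkC/tree_gdistP.
Qed.

Lemma tree_gdist_triangle y x z : (gdist x z <= gdist x y + gdist y z)%N.
Proof. by apply/gdist_le/walk_trans; apply: tree_gdistP. Qed.

Lemma tree_gdist0 x y : gdist x y = 0 -> x = y.
Proof. by move=> d0; have := tree_gdistP x y; rewrite d0 => -[[|u p] []]. Qed.

Lemma tree_gdist_adj x y : adj x y -> (gdist x y <= 1)%N.
Proof. by move/walk1/gdist_le. Qed.

(** Along a geodesic from [y] to [z] the distance to [z] is below its value at [x]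
    from the second vertex on. *)
Lemma geodesic_avoid x y z : y != x -> (gdist y z <= gdist x z)%N ->
  exists2 p, path adj y p /\ last y p = z & x \notin y :: p.
Proof.
have [n] := ubnP (gdist y z); elim: n y => // n IHn y.
rewrite ltnS => le_n yx le_yx.
have := tree_gdistP y z.
case E: (gdist y z) => [|m].
  by case=> [[|u p] [//= _ yz _]]; exists [::]; rewrite ?inE // eq_sym.
case/walkS=> y' yy' w; have dy' := gdist_le w.
have ltx : (gdist y' z < gdist x z)%N.
  by apply: leq_ltn_trans dy' _; apply: leq_trans le_yx; rewrite E.
have y'x : y' != x by apply: contraTneq ltx => ->; rewrite ltnn.
have [|p [y'p lp] xp] := IHn _ _ y'x (ltnW ltx).
  by rewrite (leq_ltn_trans dy') // -E.
exists (y' :: p); first by rewrite /= yy' y'p.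
by rewrite inE negb_or eq_sym yx.
Qed.

(** Otherwise geodesics from [y] and [y'] to [z], both avoiding [x], would
    close up with the edges at [x] to a simple cycle. *)
Lemma tree_unique_nearer x y y' z : adj x y -> adj x y' ->
  (gdist y z <= gdist x z)%N -> (gdist y' z <= gdist x z)%N -> y = y'.
Proof.
have neq u : adj x u -> u != x by apply: contraTneq => ->; rewrite adj_irr.
move=> xy xy' dy dy'.
have [p [yp lp] xp] := geodesic_avoid (neq _ xy) dy.
have [p' [y'p' lp'] xp'] := geodesic_avoid (neq _ xy') dy'.
have [r [yr lr xr]] : exists r, [/\ path adj y r, last y r = y' & x \notin y :: r].
  exists (p ++ rev (belast y' p')); split.
  - rewrite cat_path yp lp -lp' rev_path.
    by rewrite (eq_path (e' := @adj G)) // => u v; rewrite adjC.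
  - rewrite last_cat lp -lp'.
    by case: (p') => [|u s] //=; rewrite rev_cons last_rcons.
  - rewrite -cat_cons mem_cat mem_rev negb_or xp /=.
    by apply: contra xp'; rewrite lastI mem_rcons inE => ->; rewrite orbT.
case/shortenP: yr lr => s ys us sr ls; have [_ _ _ noc] := treeG.
have /noc : ucycle adj (x :: y :: s).
  apply/andP; split.
    by rewrite /= xy rcons_path ys ls adjC xy'.
  rewrite cons_uniq us andbT; apply: contra xr; rewrite !inE.
  by case/orP=> [->//|/sr ->]; rewrite orbT.
by case: s {us ys sr} ls.
Qed.

(** By [tree_unique_nearer] all neighbours but one are strictly farther. *)
Lemma tree_nearer x z : x != z -> exists y, [/\ adj x y,
  (gdist x z = (gdist y z).+1)%N &
  forall y', adj x y' -> y' != y -> gdist y' z = (gdist x z).+1].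
Proof.
move=> xz; have := tree_gdistP x z.
case E: (gdist x z) => [|n]; first by move/tree_gdist0: E xz => ->; rewrite eqxx.
case/walkS=> y xy /gdist_le dy.
have d1 u : adj x u -> (gdist u z <= (gdist x z).+1)%N.
  move=> xu; apply: leq_trans (tree_gdist_triangle x u z) _.
  by rewrite -add1n leq_add2r tree_gdist_adj // adjC.
have d2 u : adj x u -> (gdist x z <= (gdist u z).+1)%N.
  move=> xu; apply: leq_trans (tree_gdist_triangle u x z) _.
  by rewrite -add1n leq_add2r tree_gdist_adj.
exists y; split=> //.
  by apply/eqP; rewrite eqn_leq -E d2 //= E ltnS.
move=> y' xy' y'y; apply/eqP; rewrite eqn_leq -E d1 //=.
rewrite ltnNge; apply: contra y'y => le; apply/eqP.
by apply: (tree_unique_nearer xy' xy le); rewrite E ltnW.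
Qed.

End Tree.

(** * Horotrees: trees seen from an end *)

(** An explicit enumeration is easier to transport than a cardinal equality. *)
Definition has_card (A : Type) (P : A -> Prop) (q : nat) : Prop :=
  exists c : 'I_q -> A, injective c /\ forall y, P y <-> exists i, c i = y.

Lemma has_card_fin (A : Type) (P : A -> Prop) (K : finType) (c : K -> A) :
  injective c -> (forall y, P y <-> exists i, c i = y) -> has_card P #|K|.
Proof.
move=> c_inj cP; exists (c \o enum_val); split.
  by move=> i j /c_inj /enum_val_inj.
move=> y; rewrite cP; split=> [[i <-]|[i <-]].
  by exists (enum_rank i); rewrite /= enum_rankK.
by exists (enum_val i).
Qed.

Lemma has_card_set (A : Type) (P : set A) (q : nat) :
  (P #= `I_q)%card -> has_card P q.
Proof.
case/card_set_bijP => f [fI fi fs].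
have /choice[c cP] : forall i : 'I_q, exists y, P y /\ f y = i.
  by move=> i; have [|y Py fy] := fs i; [exact: ltn_ord | exists y].
exists c; split=> [i j cij|y].
  by apply: val_inj; have := (cP i).2; rewrite cij (cP j).2.
split=> [Py|[i <-]]; last exact: (cP i).1.
exists (Ordinal (fI _ Py)); apply: fi; rewrite ?inE //; first exact: (cP _).1.
exact: (cP _).2.
Qed.

(** [par] moves one step towards the fixed end and [hgt] is the Busemann
    function of that end. *)
Record horotree (q : nat) (X : Type) (par : X -> X) (hgt : X -> int) : Prop :=
  Horotree {
    hgt_par : forall x, hgt (par x) = (hgt x - 1)%R;
    children : forall x, has_card (fun y => par y = x) q;
    par_confluent : forall x y, exists m n, iter m par x = iter n par y;
    hgt_root : exists o, hgt o = 0%R }.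

Section HomTree.
Variables (q : nat) (T : hom_tree q).
Local Open Scope ring_scope.
Implicit Types (x y z : T) (m n : nat).

Let treeT : is_tree T := hom_treeP T.
Let adjC : symmetric (@adj T). Proof. by case: treeT. Qed.

Lemma eventually_const (f : nat -> nat) : (forall n, f n.+1 <= f n)%N ->
  exists N, forall n, (N <= n)%N -> f n = f N.
Proof.
move=> f_noninc; have ex : exists v, `[< exists N, f N = v >].
  by exists (f 0%N); apply/asboolP; exists 0%N.
case: (ex_minnP ex) => v /asboolP [N fN] minv; exists N => n Nn.
apply/eqP; rewrite eqn_leq fN minv ?andbT; last by apply/asboolP; exists n.
rewrite -fN; elim: n Nn => [|n IHn]; first by rewrite leqn0 => /eqP->.
rewrite leq_eqVlt => /predU1P[<- //|]; rewrite ltnS => /IHn.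
exact: leq_trans.
Qed.

Section Ray.
Variable r0 : nat -> T.
Hypothesis ray_r0 : is_ray r0.

Lemma ray_dist m n : (m <= n)%N -> gdist (r0 m) (r0 n) = (n - m)%N.
Proof. by move=> mn; rewrite ray_r0; lia. Qed.

Lemma ray_gdistS x n : (gdist x (r0 n.+1) <= (gdist x (r0 n)).+1)%N.
Proof.
have := tree_gdist_triangle treeT (r0 n) x (r0 n.+1).
by rewrite (ray_dist (leqnSn n)) subSnn addn1.
Qed.

(** The sequence [gdist x (r0 n) - n] is nonincreasing and bounded below. *)
Lemma ray_busemann_ex x : exists b : int, exists N, forall n, (N <= n)%N ->
  (gdist x (r0 n))%:Z - n%:Z = b.
Proof.
have lb n : (n <= gdist x (r0 n) + gdist x (r0 0))%N.
  have := tree_gdist_triangle treeT x (r0 0) (r0 n).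
  by rewrite ray_dist // subn0 (tree_gdistC treeT _ x) addnC.
have [|N fN] := @eventually_const
  (fun n => gdist x (r0 n) + gdist x (r0 0) - n)%N.
  move=> n /=; have := ray_gdistS x n; have := lb n; have := lb n.+1.
  by lia.
exists ((gdist x (r0 N))%:Z - N%:Z), N => n Nn.
by have := fN n Nn; have := lb n; have := lb N; lia.
Qed.

Definition ray_busemann x : int := projT1 (cid (ray_busemann_ex x)).
Local Notation beta := ray_busemann.

Lemma ray_busemannE x : exists N, forall n, (N <= n)%N ->
  (gdist x (r0 n))%:Z = beta x + n%:Z.
Proof.
rewrite /beta; case: cid => b /= [N bN]; exists N => n /bN <-.
by rewrite subrK.
Qed.

Lemma ray_busemann_ray n : beta (r0 n) = - n%:Z.
Proof.
have [N bN] := ray_busemannE (r0 n).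
have := bN (maxn n N) (leq_maxr _ _); rewrite ray_dist ?leq_maxl //.
by have := leq_maxl n N; lia.
Qed.

Lemma ray_busemann_lip x y : beta x <= beta y + (gdist x y)%:Z.
Proof.
have [N bN] := ray_busemannE x; have [M bM] := ray_busemannE y.
have := bN (maxn N M) (leq_maxl _ _); have := bM (maxn N M) (leq_maxr _ _).
by have := tree_gdist_triangle treeT y x (r0 (maxn N M)); lia.
Qed.

(** Seen from a far point of the ray, [x] has exactly one nearer neighbour. *)
Lemma ray_parent_ex x : exists y, [/\ adj x y, beta y = beta x - 1 &
  forall y', adj x y' -> y' != y -> beta y' = beta x + 1].
Proof.
have [c [c_inj cP]] := has_card_set (hom_tree_degree x).
have /choice[N bN] : forall i, exists N, forall n, (N <= n)%N ->
    (gdist (c i) (r0 n))%:Z = beta (c i) + n%:Z.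
  by move=> i; apply: ray_busemannE.
have [M bM] := ray_busemannE x.
(* Beyond all thresholds of [x] and its neighbours, and not [x] itself: the
   n-th vertex of the ray has Busemann value -n. *)
pose n := (maxn M (\max_i N i) + 1 + `|beta x|)%N.
have Mn : (M <= n)%N by rewrite /n; have := leq_maxl M (\max_i N i); lia.
have bc i : (gdist (c i) (r0 n))%:Z = beta (c i) + n%:Z.
  apply: bN; apply: leq_trans (leq_bigmax i) _.
  by rewrite /n; have := leq_maxr M (\max_i N i); lia.
have bx := bM n Mn.
have [|y [xy dy dy']] := @tree_nearer _ treeT x (r0 n).
  by apply/eqP => xr; have := ray_busemann_ray n; rewrite -xr /n; lia.
have badj u : adj x u -> (gdist u (r0 n))%:Z = beta u + n%:Z.
  by move/cP => [i <-]; apply: bc.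
exists y; split=> //; first by have := badj _ xy; lia.
by move=> y' xy' /(dy' _ xy'); have := badj _ xy'; lia.
Qed.

Definition ray_parent x : T := projT1 (cid (ray_parent_ex x)).
Local Notation par := ray_parent.

Lemma ray_parentP x : [/\ adj x (par x), beta (par x) = beta x - 1 &
  forall y', adj x y' -> y' != par x -> beta y' = beta x + 1].
Proof. by rewrite /par; case: cid. Qed.

Lemma ray_parent_unique x y : adj x y -> beta y = beta x - 1 -> y = par x.
Proof.
have [_ _ P] := ray_parentP x => xy byx; apply/eqP.
by apply: contraT => /(P _ xy); lia.
Qed.

Lemma tree_adjE x y : adj x y = (y == par x) || (x == par y).
Proof.
apply/idP/orP => [xy|[/eqP->|/eqP->]]; last 2 first.
- by have [] := ray_parentP x.
- by rewrite adjC; have [] := ray_parentP y.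
have [_ _ P] := ray_parentP x; case: eqVneq => [_|/(P _ xy) bxy]; first by left.
by right; apply/eqP/ray_parent_unique; [rewrite adjC | lia].
Qed.

Lemma ray_busemann_iter m x : beta (iter m par x) = beta x - m%:Z.
Proof.
elim: m => [|m IHm] /=; first by rewrite subr0.
by have [_ -> _] := ray_parentP (iter m par x); rewrite IHm; lia.
Qed.

Lemma walk_iter_parent m x : walk x (iter m par x) m.
Proof.
elim: m => [|m IHm]; first exact: walk0.
rewrite -addn1; apply: walk_trans IHm _.
by rewrite addn1 iterS; apply: walk1; case: (ray_parentP (iter m par x)).
Qed.

Lemma gdist_iter_parent m x : gdist x (iter m par x) = m.
Proof.
apply/eqP; rewrite eqn_leq (gdist_le (walk_iter_parent m x)) /=.
by have := ray_busemann_lip x (iter m par x); rewrite ray_busemann_iter; lia.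
Qed.

(** The Busemann function is 1-Lipschitz, so it drops at every step of a walk
    along which it drops by the length. *)
Lemma steep_walk m x y : walk x y m -> beta y = beta x - m%:Z ->
  iter m par x = y.
Proof.
elim: m x => [|m IHm] x; first by case=> [[|u p] []].
case/walkS => u xu w bxy; rewrite iterSr.
have b1 := ray_busemann_lip x u; have := tree_gdist_adj xu => d1.
have b2 := ray_busemann_lip u y; have := gdist_le w => d2.
have -> : par x = u by apply/esym/ray_parent_unique => //; lia.
by apply: IHm => //; lia.
Qed.

Lemma iter_parent_ray m n : iter m par (r0 n) = r0 (n + m).
Proof.
apply: steep_walk; last by rewrite !ray_busemann_ray; lia.
have := tree_gdistP treeT (r0 n) (r0 (n + m)).
by rewrite ray_dist ?leq_addr // addKn.
Qed.

Lemma iter_parent_to_ray x : exists m n, iter m par x = r0 n.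
Proof.
have [N bN] := ray_busemannE x.
exists (gdist x (r0 N)), N; apply: steep_walk; first exact: tree_gdistP.
by rewrite bN // ray_busemann_ray; lia.
Qed.

Lemma ray_confluent x y : exists m n, iter m par x = iter n par y.
Proof.
have [m [i xi]] := iter_parent_to_ray x; have [n [j yj]] := iter_parent_to_ray y.
exists (j + m)%N, (i + n)%N.
by rewrite !iterD xi yj !iter_parent_ray addnC.
Qed.

Lemma ray_children x : has_card (fun y => par y = x) q.
Proof.
have [c [c_inj cP]] := has_card_set (hom_tree_degree x).
have [+ bp _] := ray_parentP x; case/cP => i0 ci0.
exists (c \o lift i0); split; first by move=> i j /c_inj /lift_inj.
move=> y; split=> [yx|[i <-]].
  have /cP[i ci] : adj x y by rewrite tree_adjE yx eqxx orbT.
  have [j|ii0] := unliftP i0 i; first by move=> ij; exists j; rewrite /= -ij.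
  have [_ b2 _] := ray_parentP y.
  by move: bp; rewrite -ci0 -ii0 ci -yx b2; lia.
have /= : adj x (c (lift i0 i)) by apply/cP; exists (lift i0 i).
rewrite tree_adjE -ci0 (inj_eq c_inj) eq_sym (negPf (neq_lift _ _)) /=.
by move/eqP.
Qed.

(** Beyond some index the ray runs inside [r0], and an isometry of a half-line
    into [nat] is eventually a translation. *)
Lemma equiv_rayE r : is_ray r -> ray_equiv r0 r ->
  forall k, r k = iter k par (r 0%N).
Proof.
move=> ray_r eqv.
have r_inj i j : r i = r j -> i = j.
  by move=> rij; have := ray_r i j; rewrite rij ray_r; lia.
have [I rI] : exists I, forall i, (I <= i)%N -> exists a, r i = r0 a.
  have /finite_seqP[s sP] := eqv.
  have /choice[N NP] : forall u : T, exists N, forall i, r i = u -> (i < N)%N.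
    move=> u; have [[i ri]|no] := pselect (exists i, r i = u).
      by exists i.+1 => j rj; rewrite (r_inj j i) // rj.
    by exists 0%N => i ri; case: no; exists i.
  exists (\max_(u <- s) N u)%N => i le_i.
  have [[a _ ra]|no] := pselect (range r0 (r i)); first by exists a.
  have /= ri_s : [set` s]%classic (r i) by rewrite -sP; right; split=> //; exists i.
  have := NP _ i erefl; rewrite ltnNge => /negP[].
  by apply: leq_trans le_i; apply: leq_bigmax_seq.
have [a ra] := rI I (leqnn I).
have rE i : (I + a < i)%N -> r i = r0 (a + (i - I))%N.
  move=> lt_i; have [|b rb] := rI i; first by lia.
  by have := ray_r i I; rewrite rb ra ray_r0 => dab; congr r0; lia.
have br k : beta (r k) = I%:Z - a%:Z - k%:Z.
  have [N bN] := ray_busemannE (r k).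
  pose i := (I + a + N + k + 1)%N.
  have rik : r i = r0 (a + (i - I)) by apply: rE; rewrite /i; lia.
  have := bN (a + (i - I))%N; rewrite -rik ray_r /i => /(_ ltac:(lia)).
  by lia.
move=> k; apply/esym/steep_walk; last by rewrite !br; lia.
have := tree_gdistP treeT (r 0%N) (r k); rewrite ray_r.
by congr walk; lia.
Qed.

Lemma iter_parent_ray_equiv x :
  is_ray (fun n => iter n par x) /\ ray_equiv r0 (fun n => iter n par x).
Proof.
have dist m n : (m <= n)%N -> gdist (iter m par x) (iter n par x) = (n - m)%N.
  by move=> /subnK {1}<-; rewrite iterD gdist_iter_parent.
split.
  move=> m n; have [mn|/ltnW nm] := leqP m n; first by rewrite dist //; lia.
  by rewrite tree_gdistC // dist //; lia.
have [m [n xr]] := iter_parent_to_ray x; apply/finite_seqP.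
apply/finite_seqP.
apply: (@sub_finite_set _ _
  ([set` [seq r0 i | i <- iota 0 n]] `|` [set` [seq iter i par x | i <- iota 0 m]])%classic).
  move=> y [[[i _ <-] no]|[[i _ <-] no]]; [left|right];
    apply/mapP; exists i => //; rewrite mem_iota add0n /= ltnNge;
    apply/negP => le; apply: no.
    exists (i - n + m)%N => //=.
    by rewrite iterD xr iter_parent_ray; congr r0; lia.
  exists (n + (i - m))%N => //=.
  by rewrite -iter_parent_ray -xr -iterD subnK.
by rewrite finite_setU; split; apply: finite_seq.
Qed.

Hypothesis end_r0 : @tree_end q T = [set r' | is_ray r' /\ ray_equiv r0 r']%classic.

Lemma tree_endE (r : nat -> T) : tree_end r <-> forall k, r k = iter k par (r 0%N).
Proof.
rewrite end_r0; split=> [[ray_r eqv]|rE]; first exact: equiv_rayE.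
by rewrite (_ : r = fun n => iter n par (r 0%N)); [apply: iter_parent_ray_equiv|apply/funext].
Qed.

(** The rays of the end are the orbits of the parent map, so the confluent is the
    first common ancestor. *)
Lemma is_confluentE x y v : is_confluent x y v <->
  exists m n, [/\ iter m par x = v, iter n par y = v,
    forall i j, (i < m)%N -> iter i par x <> iter j par y &
    forall i j, (j < n)%N -> iter i par x <> iter j par y].
Proof.
split.
  move=> [r [r' [m [n [[/tree_endE rE /tree_endE rE' rx ry] [rm rn nr nr']]]]]].
  rewrite rx in rE; rewrite ry in rE'.
  exists m, n; split; rewrite -?rE -?rE' //.
    by move=> i j im xy; apply: (nr i im); exists j; rewrite ?rE ?rE'.
  by move=> i j jn xy; apply: (nr' j jn); exists i; rewrite ?rE ?rE'.
move=> [m [n [xv yv nx ny]]].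
exists (fun k => iter k par x), (fun k => iter k par y), m, n.
split; split=> //; try exact/tree_endE.
  by move=> i im [j _ xy]; apply: (nx i j).
by move=> j jn [i _ xy]; apply: (ny i j).
Qed.

Lemma confluent_ex x y : exists v, is_confluent x y v.
Proof.
have ex : exists m, `[< exists n, iter m par x = iter n par y >].
  by have [m [n xy]] := ray_confluent x y; exists m; apply/asboolP; exists n.
case: (ex_minnP ex) => m /asboolP[n xy] min_m.
exists (iter m par x); apply/is_confluentE; exists m, n; split=> // i j.
  move=> im xij; move: im; rewrite ltnNge => /negP[].
  by apply: min_m; apply/asboolP; exists j.
move=> jn xij; have le_mi : (m <= i)%N.
  by apply: min_m; apply/asboolP; exists j.
have := congr1 beta xij; have := congr1 beta xy.
by rewrite !ray_busemann_iter; lia.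
Qed.

(** The two distances to the confluent are the two numbers of generations, whose
    difference the function [beta] also measures. *)
Lemma busemannE x : busemann x = beta x - beta (origin T).
Proof.
have /is_confluentE[m [n [xv ov _ _]]] := xgetPex x (confluent_ex x (origin T)).
rewrite /busemann /confluent -{1}xv -ov !gdist_iter_parent.
by have := congr1 beta (etrans xv (esym ov)); rewrite !ray_busemann_iter; lia.
Qed.

End Ray.

(** The parent of [x] is its only neighbour nearer to the far points of a ray of
    the end, and the rays of the end are exactly the orbits of this parent map. *)
Theorem hom_tree_horotree : exists par : T -> T,
  (forall x y : T, adj x y = (y == par x) || (x == par y)) /\
  horotree q par (@busemann q T).
Proof.
have [r0 ray_r0 end_r0] := tree_endP T; exists (ray_parent ray_r0); split.
  exact: tree_adjE.
split.
- move=> x; rewrite !(busemannE ray_r0 end_r0).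
  by have [_ -> _] := ray_parentP ray_r0 x; lia.
- exact: ray_children.
- exact: ray_confluent.
- by exists (origin T); rewrite (busemannE ray_r0 end_r0) subrr.
Qed.

End HomTree.

(** * Uniqueness of the horotree *)

Section HorotreeTheory.
Variables (q : nat) (X : Type) (par : X -> X) (hgt : X -> int).
Hypothesis horoX : horotree q par hgt.
Local Open Scope ring_scope.

Lemma hgt_iter m x : hgt (iter m par x) = hgt x - m%:Z.
Proof.
elim: m => [|m IHm] /=; first by rewrite subr0.
by rewrite (hgt_par horoX) IHm; lia.
Qed.

Lemma descendant_ex m x : (0 < q)%N -> exists w, iter m par w = x.
Proof.
move=> q0; elim: m x => [|m IHm] x; first by exists x.
have [y yx] := IHm x; have [c [_ cP]] := children horoX y.
exists (c (Ordinal q0)); rewrite iterSr (_ : par _ = y) //.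
by apply/cP; eexists.
Qed.

(** The children are numbered so that the path from [o] to the end carries the
    label [i0] throughout. *)
Lemma labelling (o : X) (i0 : 'I_q) :
  exists (child : X -> 'I_q -> X) (lab : X -> 'I_q),
    [/\ forall x i, par (child x i) = x, forall x i, lab (child x i) = i,
        forall y, child (par y) (lab y) = y & forall n, lab (iter n par o) = i0].
Proof.
have /choice[child childP] : forall x, exists c : 'I_q -> X,
    [/\ injective c, forall y, par y = x <-> exists i, c i = y &
        forall n, x = iter n.+1 par o -> c i0 = iter n par o].
  move=> x; have [c [c_inj cP]] := children horoX x.
  have [[n xn]|no] := pselect (exists n, x = iter n.+1 par o); last first.
    by exists c; split=> // n xn; case: no; exists n.
  have /cP[i1 ci1] : par (iter n par o) = x by [].
  exists (c \o tperm i0 i1); split.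
  - by move=> i j /c_inj /perm_inj.
  - move=> y; rewrite cP; split=> -[i <-]; last by eexists.
    by exists (tperm i0 i1 i); rewrite /= tpermK.
  - move=> m xm; have : hgt (iter n.+1 par o) = hgt (iter m.+1 par o).
      by rewrite -xn -xm.
    by rewrite !hgt_iter /= tpermL ci1 => hnm; congr iter; lia.
have /choice[lab labP] : forall y, exists i, child (par y) i = y.
  by move=> y; have [_ cP _] := childP (par y); apply/cP.
have parK x i : par (child x i) = x.
  by have [_ cP _] := childP x; apply/cP; exists i.
have labK x i : lab (child x i) = i.
  have [c_inj _ _] := childP x; apply: c_inj.
  by rewrite -{1}(parK x i) labP.
exists child, lab; split=> // n.
have [_ _ c0] := childP (iter n.+1 par o).
by rewrite -(c0 n erefl) labK.
Qed.

End HorotreeTheory.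

(** With the path from a root of height [0] to the end labelled by one fixed
    letter, a vertex is the same thing as its height and the word of labels
    read on its way to the end. *)
Theorem horotree_unique (q : nat) (X Y : Type) (parX : X -> X) (parY : Y -> Y)
    (hX : X -> int) (hY : Y -> int) :
  (0 < q)%N -> horotree q parX hX -> horotree q parY hY ->
  exists (f : X -> Y) (g : Y -> X),
    [/\ cancel f g, cancel g f, forall x, f (parX x) = parY (f x) &
        forall x, hY (f x) = hX x].
Proof.
move=> q0 horoX horoY.
have [oX oX0] := hgt_root horoX; have [oY oY0] := hgt_root horoY.
have [cX [lX [parXK lXK cXK lX0]]] := labelling horoX oX (Ordinal q0).
have [cY [lY [parYK lYK cYK lY0]]] := labelling horoY oY (Ordinal q0).
pose same x y := hX x = hY y /\
  forall i, lX (iter i parX x) = lY (iter i parY y).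
(* Both facts are stated for arbitrary horotrees, to be used in both directions. *)
have total (U V : Type) (pU : U -> U) (pV : V -> V) hU hV oU oV
    (lU : U -> 'I_q) (lV : V -> 'I_q) (cV : V -> 'I_q -> V) :
    horotree q pU hU -> horotree q pV hV -> hU oU = 0%R -> hV oV = 0%R ->
    (forall n, lU (iter n pU oU) = Ordinal q0) ->
    (forall n, lV (iter n pV oV) = Ordinal q0) ->
    (forall x i, pV (cV x i) = x) -> (forall x i, lV (cV x i) = i) ->
    forall u, exists v, hU u = hV v /\
      forall i, lU (iter i pU u) = lV (iter i pV v).
  move=> horoU horoV oU0 oV0 lU0 lV0 pVK lVK u.
  have [m [n]] := par_confluent horoU u oU.
  elim: m u => [|m IHm] u un.
    exists (iter n pV oV); rewrite /= in un.
    rewrite un (hgt_iter horoU) (hgt_iter horoV) oU0 oV0; split=> // i.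
    by rewrite -!iterD lU0 lV0.
  have [|v [huv luv]] := IHm (pU u); first by rewrite -iterSr.
  exists (cV v (lU u)); split.
    have := hgt_par horoU u; have := hgt_par horoV (cV v (lU u)).
    by rewrite pVK; lia.
  by case=> [|i]; rewrite ?lVK // !iterSr pVK luv.
have inj (U : Type) (pU : U -> U) hU (lU : U -> 'I_q) (cU : U -> 'I_q -> U) :
    horotree q pU hU -> (forall y, cU (pU y) (lU y) = y) ->
    forall u u', hU u = hU u' ->
      (forall i, lU (iter i pU u) = lU (iter i pU u')) -> u = u'.
  move=> horoU cUK u u' huu' luu'.
  have [m [n uu']] := par_confluent horoU u u'.
  have mn : n = m.
    by have := congr1 hU uu'; rewrite !(hgt_iter horoU) huu'; lia.
  rewrite {}mn in uu'; elim: m uu' => // m IHm uu'; apply: IHm.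
  by rewrite -[LHS]cUK -[RHS]cUK luu' -!iterS uu'.
have /choice[f fP] : forall x, exists y, same x y.
  exact: (total _ _ _ _ _ _ _ _ _ _ _ horoX horoY oX0 oY0).
have /choice[g gP] : forall y, exists x, same x y.
  move=> y; have [x [hxy lxy]] :=
    total _ _ _ _ _ _ _ _ _ _ _ horoY horoX oY0 oX0 lY0 lX0 parXK lXK y.
  by exists x; split.
have sameX x x' y : same x y -> same x' y -> x = x'.
  move=> [hx lx] [hx' lx']; apply: (inj _ _ _ _ _ horoX cXK).
    by rewrite hx.
  by move=> i; rewrite lx.
have sameY x y y' : same x y -> same x y' -> y = y'.
  move=> [hy ly] [hy' ly']; apply: (inj _ _ _ _ _ horoY cYK).
    by rewrite -hy.
  by move=> i; rewrite -ly.
exists f, g; split.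
- by move=> x; apply: (sameX _ _ (f x)); [apply: gP | apply: fP].
- by move=> y; apply: (sameY (g y)); [apply: fP | apply: gP].
- move=> x; apply: (sameY (parX x)); first exact: fP.
  have [hx lx] := fP x; split; last by move=> i; rewrite -!iterSr lx.
  by rewrite (hgt_par horoX) (hgt_par horoY) hx.
- by move=> x; case: (fP x).
Qed.

(** * Keeping every s-th level *)

Section Sublevels.
Variables (q s : nat) (X : Type) (par : X -> X) (hgt : X -> int).
Hypotheses (q_gt0 : (0 < q)%N) (s_gt0 : (0 < s)%N) (horoX : horotree q par hgt).
Local Open Scope ring_scope.

Lemma descendant_card m x : has_card (fun y => iter m par y = x) (q ^ m).
Proof.
elim: m x => [|m IHm] x.
  rewrite expn0 -card_unit; apply: (@has_card_fin _ _ _ (fun=> x)).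
    by case=> -[].
  by move=> y; split=> [<-|[_ <-]] //; exists tt.
have [c [c_inj cP]] := IHm x.
have /choice[d dP] := fun y => children horoX y.
have -> : (q ^ m.+1 = #|{: 'I_(q ^ m) * 'I_q}|)%N.
  by rewrite card_prod !card_ord expnSr.
apply: (@has_card_fin _ _ _ (fun ij => d (c ij.1) ij.2)).
  move=> [i j] [i' j'] /= dd.
  have [dc_inj dcP] := dP (c i); have [_ dcP'] := dP (c i').
  have cc : c i = c i'.
    have <- : par (d (c i) j) = c i by apply/dcP; exists j.
    by apply/dcP'; exists j'.
  have ii' := c_inj _ _ cc; rewrite ii' in dd *.
  by have [d_inj _] := dP (c i'); rewrite (d_inj _ _ dd).
move=> y; rewrite iterSr; split.
  case/cP=> i ci; have [_ dcP] := dP (par y).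
  have [j dj] : exists j, d (par y) j = y by apply/dcP.
  by exists (i, j); rewrite /= ci.
move=> [[i j] /= <-]; have [_ dcP] := dP (c i).
have -> : par (d (c i) j) = c i by apply/dcP; exists j.
by apply/cP; exists i.
Qed.

Definition sublevel : Type := {x : X | (s%:Z %| hgt x)%Z}.

Lemma sublevel_parP (x : sublevel) : (s%:Z %| hgt (iter s par (val x)))%Z.
Proof.
have /dvdzP[k xk] := svalP x.
by rewrite (hgt_iter horoX) xk -[X in _ - X]mul1r -mulrBl dvdz_mull.
Qed.

Definition sublevel_par (x : sublevel) : sublevel :=
  exist (fun x => is_true (s%:Z %| hgt x)%Z) (iter s par (val x)) (sublevel_parP x).

Definition sublevel_hgt (x : sublevel) : int := (hgt (val x) %/ s%:Z)%Z.

Lemma sublevel_hgtE (x : sublevel) : hgt (val x) = sublevel_hgt x * s%:Z.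
Proof. by rewrite /sublevel_hgt divzK //; apply: (svalP x). Qed.

Lemma val_sublevel_iter m x :
  val (iter m sublevel_par x) = iter (m * s) par (val x).
Proof. by elim: m => //= m ->; rewrite -iterD. Qed.

Lemma sublevel_horotree : horotree (q ^ s) sublevel_par sublevel_hgt.
Proof.
split.
- move=> x; rewrite /sublevel_hgt /= (hgt_iter horoX) sublevel_hgtE.
  by rewrite -[s%:Z in X in _ - X]mul1r -mulrBl !mulzK //; lia.
- move=> x; have [c [c_inj cP]] := descendant_card s (val x).
  have c_dvd i : (s%:Z %| hgt (c i))%Z.
    have ci : iter s par (c i) = val x by apply/cP; exists i.
    have /dvdzP[k] := svalP x; rewrite -[sval x]ci (hgt_iter horoX) => xk.
    by apply/dvdzP; exists (k + 1); rewrite mulrDl -xk mul1r subrK.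
  exists (fun i => exist (fun x => is_true (s%:Z %| hgt x)%Z) (c i) (c_dvd i)).
  split=> [i j [] /c_inj //|y].
  split=> [yx|[i <-]]; last by apply: val_inj; apply/cP; exists i.
  have [i ci] : exists i, c i = val y by apply/cP; rewrite -yx.
  by exists i; apply: val_inj.
- move=> x y; have [m [n xy]] := par_confluent horoX (val x) (val y).
  have mn : (m%:Z - n%:Z) = (sublevel_hgt x - sublevel_hgt y) * s%:Z.
    by have := congr1 hgt xy; rewrite !(hgt_iter horoX) !sublevel_hgtE; lia.
  set k := (sublevel_hgt x - sublevel_hgt y) in mn.
  (* [m * s.-1] further steps make both numbers of generations divisible by [s]. *)
  exists m, `|m%:Z - k|%N; apply: val_inj.
  have mE : (m * s = m * s.-1 + m)%N by case: (s) s_gt0 => //= t _; lia.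
  have nE : (`|m%:Z - k| * s = m * s.-1 + n)%N.
    have ks : (m%:Z - k) * s%:Z = (m * s.-1 + n)%:Z.
      by rewrite mulrBl -mn -PoszM mE; lia.
    have mk_ge0 : 0 <= m%:Z - k.
      by rewrite -(@pmulr_lge0 _ s%:Z) ?ltz_nat // ks.
    apply/eqP; rewrite -eqz_nat PoszM abszE ger0_norm //; exact/eqP.
  by rewrite !val_sublevel_iter mE nE !iterD xy.
- have [o o0] := hgt_root horoX.
  have o_dvd : (s%:Z %| hgt o)%Z by rewrite o0.
  exists (exist (fun x => is_true (s%:Z %| hgt x)%Z) o o_dvd).
  by rewrite /sublevel_hgt /= o0 div0z.
Qed.

End Sublevels.

(** * Moving in a horocyclic product *)

(** A bound on the tree distance in terms of the parent map alone. *)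
Definition cousins (X : Type) (par : X -> X) (N : nat) (x y : X) : Prop :=
  exists m n, [/\ (m <= N)%N, (n <= N)%N & iter m par x = iter n par y].

Section Cousins.
Variables (X : Type) (par : X -> X).
Implicit Types x y z : X.

Lemma cousinsxx N x : cousins par N x x.
Proof. by exists 0%N, 0%N. Qed.

Lemma cousins_sym N x y : cousins par N x y -> cousins par N y x.
Proof. by move=> [m [n [mN nN xy]]]; exists n, m. Qed.

Lemma cousins_iter m x : cousins par m x (iter m par x).
Proof. by exists m, 0%N. Qed.

Lemma cousins_weaken N M x y : (N <= M)%N -> cousins par N x y -> cousins par M x y.
Proof.
move=> NM [m [n [mN nN xy]]].
by exists m, n; split=> //; [apply: leq_trans mN NM|apply: leq_trans nN NM].
Qed.

Lemma cousins_trans y N M x z :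
  cousins par N x y -> cousins par M y z -> cousins par (N + M) x z.
Proof.
move=> [m [n [mN nN xy]]] [m' [n' [m'M n'M yz]]].
have [le|/ltnW le] := leqP n m'.
  exists (m' - n + m)%N, n'; split; [lia|lia|].
  by rewrite iterD xy -iterD subnK.
exists m, (n - m' + n')%N; split; [lia|lia|].
by rewrite [in RHS]iterD -yz -iterD subnK.
Qed.

Lemma cousins_descend (f : X -> X) : (forall x, par (f x) = x) ->
  forall m x, cousins par m x (iter m f x).
Proof.
move=> parK m x; apply: cousins_sym; exists m, 0%N; split=> //.
elim: m x => // m IHm x; rewrite iterSr iterS parK; exact: IHm.
Qed.

End Cousins.

Definition reach (G : graph) (N : nat) (x y : G) : Prop :=
  exists2 n, (n <= N)%N & walk x y n.

Lemma reach_trans (G : graph) (y x z : G) N M :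
  reach N x y -> reach M y z -> reach (N + M) x z.
Proof.
move=> [n nN xy] [m mM yz]; exists (n + m)%N; first exact: leq_add.
exact: walk_trans xy yz.
Qed.

Lemma reach_weaken (G : graph) N M (x y : G) :
  (N <= M)%N -> reach N x y -> reach M x y.
Proof. by move=> NM [n nN xy]; exists n => //; apply: leq_trans NM. Qed.

Lemma reach_walk (G H : graph) (f : G -> H) (C : nat) :
  (forall x y, adj x y -> reach C (f x) (f y)) ->
  forall x y n, walk x y n -> reach (C * n) (f x) (f y).
Proof.
move=> fC x y n; elim: n x => [|n IHn] x.
  by case=> [[|u p] [//= _ -> _]]; exists 0%N; rewrite ?muln0 //; apply: walk0.
by case/walkS=> u /fC xu /IHn uy; rewrite mulnS; apply: reach_trans xu uy.
Qed.

Section DLMoves.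
Variables (q d : nat) (T : hom_tree q) (par : T -> T).
Hypothesis q_gt0 : (0 < q)%N.
Hypothesis adjE : forall x y : T, adj x y = (y == par x) || (x == par y).
Hypothesis horoT : horotree q par (@busemann q T).
Local Open Scope ring_scope.
Implicit Types x y z : DL d T.

Lemma DL_adjP x y : reflect (exists i j, [/\ i != j, adj (val x i) (val y i),
    adj (val x j) (val y j) & forall k, k != i -> k != j -> val x k = val y k])
  (adj x y).
Proof.
apply: (iffP existsP) => [[i /existsP[j /and4P[ij ai aj /forallP E]]]|].
  exists i, j; split=> // k ki kj; apply/eqP.
  by have /implyP := E k; rewrite ki kj; apply.
move=> [i [j [ij ai aj E]]]; exists i; apply/existsP; exists j.
rewrite ij ai aj; apply/forallP => k.
by apply/implyP => /andP[ki kj]; rewrite E.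
Qed.

Lemma tree_adjC (u v : T) : adj u v = adj v u.
Proof. by rewrite !adjE orbC. Qed.

Lemma DL_adjC : symmetric (@adj (DL d T)).
Proof.
have sub x y : adj x y -> adj y x.
  move=> /DL_adjP[i [j [ij ai aj E]]]; apply/DL_adjP; exists i, j.
  by split=> //; rewrite 1?tree_adjC // => k ki kj; rewrite E.
by move=> x y; apply/idP/idP; apply: sub.
Qed.

Definition put2 (f : {ffun 'I_d -> T}) (i j : 'I_d) (u v : T) :=
  [ffun k => if k == i then u else if k == j then v else f k].

Lemma put2_fst f i j u v : put2 f i j u v i = u.
Proof. by rewrite ffunE eqxx. Qed.

Lemma put2_snd f i j u v : i != j -> put2 f i j u v j = v.
Proof. by move=> /negPf ij; rewrite ffunE eq_sym ij eqxx. Qed.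

Lemma put2_other f i j u v k : k != i -> k != j -> put2 f i j u v k = f k.
Proof. by move=> /negPf ki /negPf kj; rewrite ffunE ki kj. Qed.

Lemma put2_level (f : {ffun 'I_d -> T}) i j u v : i != j ->
  busemann u + busemann v = busemann (f i) + busemann (f j) ->
  \sum_k busemann (put2 f i j u v k) = \sum_k busemann (f k).
Proof.
move=> ij uv; rewrite (bigD1 i) // (bigD1 j) 1?eq_sym //=.
rewrite [RHS](bigD1 i) // [in RHS](bigD1 j) 1?eq_sym //=.
rewrite put2_fst put2_snd // (eq_bigr (fun k => busemann (f k))); last first.
  by move=> k /andP[ki kj]; rewrite put2_other.
have sum4 (a b a' b' t : int) : a + b = a' + b' -> a + (b + t) = a' + (b' + t).
  by move=> ab; rewrite !addrA ab.
exact: sum4.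
Qed.

(** Coordinate [i] descends to [v], and coordinate [j] pays for it by going up. *)
Lemma DL_shift x (i j : 'I_d) m v : i != j -> iter m par v = val x i ->
  exists z, [/\ walk x z m, val z i = v, val z j = iter m par (val x j) &
    forall k, k != i -> k != j -> val z k = val x k].
Proof.
move=> ij; elim: m v => [|m IHm] v xv.
  by exists x; split=> //; apply: walk0.
have [|z [w zi zj zk]] := IHm (par v); first by rewrite -iterSr.
have z'P : \sum_k busemann (put2 (val z) i j v (par (val z j)) k) == 0.
  rewrite put2_level ?(eqP (valP z)) // zi.
  by rewrite !(hgt_par horoT); ring.
exists (exist (fun f : {ffun 'I_d -> T} => is_true (\sum_k busemann (f k) == 0)) _ z'P).
split=> /=.
- rewrite -addn1; apply: walk_trans w (walk1 _); apply/DL_adjP; exists i, j.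
  rewrite /= put2_fst put2_snd // !adjE zi !eqxx ?orbT; split=> //.
  by move=> k ki kj; rewrite put2_other.
- by rewrite put2_fst.
- by rewrite put2_snd // zj.
- by move=> k ki kj; rewrite put2_other // zk.
Qed.

(** Coordinate [i] goes through the common ancestor, and coordinate [j] first
    descends and then goes up. *)
Lemma DL_move1 x (i j : 'I_d) N v : i != j -> cousins par N (val x i) v ->
  exists z, [/\ reach (N + N) x z, val z i = v,
    cousins par N (val x j) (val z j) &
    forall k, k != i -> k != j -> val z k = val x k].
Proof.
move=> ij [m [n [mN nN xv]]].
have [w wx] := descendant_ex horoT m (val x j) q_gt0.
have ji : j != i by rewrite eq_sym.
have [z [xz zj zi zk]] := DL_shift ji wx.
have [|z' [zz' z'i z'j z'k]] := @DL_shift z i j n v ij; first by rewrite zi xv.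
exists z'; split=> //.
- by exists (m + n)%N; [apply: leq_add | apply: walk_trans xz zz'].
- exists n, m; split=> //; rewrite z'j zj -iterD addnC iterD.
  by rewrite wx.
- by move=> k ki kj; rewrite z'k // zk.
Qed.

Lemma DL_move_all (j : 'I_d) N x y (s : seq 'I_d) : j \notin s ->
  (forall i, cousins par N (val x i) (val y i)) ->
  exists z, [/\ reach (size s * (N + N)) x z,
    forall i, i \in s -> val z i = val y i,
    cousins par (size s * N) (val x j) (val z j) &
    forall i, i \notin s -> i != j -> val z i = val x i].
Proof.
move=> + xy; elim: s => [_|i s IHs].
  by exists x; split=> //; [exists 0%N => //; apply: walk0 | apply: cousinsxx].
rewrite inE negb_or => /andP[ji js]; have [z [xz zs zj zk]] := IHs js.
have zi : cousins par N (val z i) (val y i).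
  have [/zs->|i_s] := boolP (i \in s); first exact: cousinsxx.
  by rewrite zk // eq_sym.
have ij : i != j by rewrite eq_sym.
have [z' [zz' z'i z'j z'k]] := DL_move1 ij zi.
exists z'; split.
- by rewrite /= mulSn addnC; apply: reach_trans xz zz'.
- move=> k; rewrite inE; case: (eqVneq k i) => [-> //|ki /= ks].
  by rewrite z'k ?zs //; apply: contraNneq js => <-.
- by rewrite /= mulSn addnC; apply: cousins_trans zj z'j.
- move=> k; rewrite inE negb_or => /andP[ki ks] kj.
  by rewrite z'k // zk.
Qed.

(** The coordinate used for compensation ends at the right height, so it can be
    moved up and down while another coordinate makes a detour and comes back. *)
Lemma DL_move_last (i j : 'I_d) N x y : i != j ->
  (forall k, k != j -> val x k = val y k) ->
  cousins par N (val x j) (val y j) -> reach (N + N) x y.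
Proof.
move=> ij xy [m [n [mN nN xyj]]].
have ji : j != i by rewrite eq_sym.
have hj : busemann (val x j) = busemann (val y j).
  have := eqP (valP x); rewrite (bigD1 j) //= => sx.
  have := eqP (valP y); rewrite (bigD1 j) //= => sy.
  have E : \sum_(k | k != j) busemann (val x k) =
      \sum_(k | k != j) busemann (val y k).
    by apply: eq_bigr => k /xy ->.
  by rewrite E in sx; apply: addIr (etrans sx (esym sy)).
have mn : n = m.
  by have := congr1 (@busemann q T) xyj; rewrite !(hgt_iter horoT) hj; lia.
rewrite {n}mn in nN xyj.
have [w wx] := descendant_ex horoT m (val x i) q_gt0.
have [z [xz zi zj zk]] := DL_shift ij wx.
have [|z' [zz' z'j z'i z'k]] := @DL_shift z j i m (val y j) ji.
  by rewrite zj.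
have -> : y = z'.
  apply: val_inj; apply/ffunP => k.
  have [->|kj] := eqVneq k j; first by rewrite z'j.
  have [->|ki] := eqVneq k i; first by rewrite z'i zi wx xy.
  by rewrite z'k // zk // xy.
by exists (m + m)%N; [apply: leq_add | apply: walk_trans xz zz'].
Qed.

(** Correcting the other coordinates costs [2 * N] steps each and moves the
    compensating coordinate by at most [d.-1 * N]; its own correction then costs
    at most twice [d * N]. *)
Theorem DL_cousins_reach N x y : (1 < d)%N ->
  (forall i, cousins par N (val x i) (val y i)) -> reach (6 * (d * N)) x y.
Proof.
move=> d_gt1 xy; pose j := Ordinal d_gt1; pose i := Ordinal (ltnW d_gt1).
have jP : j \notin rem j (enum 'I_d) by rewrite mem_rem_uniqF ?enum_uniq.
have [z [xz zs zj _]] := DL_move_all jP xy.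
have size_s : size (rem j (enum 'I_d)) = d.-1.
  by rewrite size_rem ?mem_enum // size_enum_ord.
have zy : reach (d * N + d * N) z y.
  apply: (@DL_move_last i j) => // [k kj|].
    by apply: zs; rewrite mem_rem_uniq ?enum_uniq // !inE kj mem_enum.
  have -> : (d * N = d.-1 * N + N)%N by rewrite -{1}(prednK (ltnW d_gt1)) mulSn addnC.
  by apply: cousins_trans (xy j); apply: cousins_sym; rewrite -size_s.
apply: reach_weaken (reach_trans xz zy); rewrite size_s.
have : (d.-1 * (N + N) <= d * (N + N))%N by rewrite leq_mul2r leq_pred orbT.
by rewrite mulnDr; lia.
Qed.

Theorem DL_connected : (1 < d)%N -> connected_graph (DL d T).
Proof.
move=> d_gt1 x y.
have /choice[N NP] : forall i, exists N, cousins par N (val x i) (val y i).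
  move=> i; have [m [n xy]] := par_confluent horoT (val x i) (val y i).
  by exists (maxn m n), m, n; rewrite leq_maxl leq_maxr.
have [|n _ w] := @DL_cousins_reach (\max_i N i) x y d_gt1; last by exists n.
by move=> i; apply: cousins_weaken (NP i); apply: leq_bigmax.
Qed.

End DLMoves.

(** * Quasi-isometries from Lipschitz quasi-inverses *)

Section QuasiIsometry.
Variable R : realType.
Local Open Scope ring_scope.
Local Open Scope ereal_scope.

Variant edist_spec (G : graph) (x y : G) : \bar R -> Prop :=
  | EdistWalk n of walk x y n : edist_spec x y n%:R%:E
  | EdistNone of (forall n, ~ walk x y n) : edist_spec x y +oo.

Lemma edistP (G : graph) (x y : G) : edist_spec x y (edist R x y).
Proof.
rewrite /edist; case: asboolP => [[n w]|no]; constructor.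
  exact: gdistP w.
by move=> n w; apply: no; exists n.
Qed.

Lemma edist_reach (G : graph) (x y : G) N :
  reach N x y -> edist R x y <= N%:R%:E.
Proof.
move=> [n nN w]; rewrite /edist asboolT; last by exists n.
by rewrite lee_fin ler_nat (leq_trans (gdist_le w)).
Qed.

(** Walks are mapped to walks in both directions, so that infinite distances
    correspond to each other. *)
Lemma quasi_isometric_lipschitz (G H : graph) (phi : G -> H) (psi : H -> G) C :
  (forall x y, adj x y -> reach C (phi x) (phi y)) ->
  (forall x y, adj x y -> reach C (psi x) (psi y)) ->
  (forall x, reach C x (psi (phi x))) -> (forall x, reach C (psi (phi x)) x) ->
  (forall y, reach C y (phi (psi y))) ->
  quasi_isometric (@edist R G) (@edist R H).
Proof.
move=> phiC psiC gf1 gf2 fg; exists phi, C.+1%:R, (C + C)%:R.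
split; rewrite ?ltr0n ?ler0n //; last first.
  move=> y; apply: ge_ereal_inf; exists (edist R y (phi (psi y))).
    by exists (psi y).
  by apply: le_trans (edist_reach (fg y)) _; rewrite lee_fin ler_nat leq_addr.
move=> x y; split.
  case: (edistP x y) => [n w|_]; last exact: leey.
  have [k kC w'] := reach_walk phiC w.
  have := edist_reach (ex_intro2 _ _ k kC w').
  case: (edistP (phi x) (phi y)) => [m _|_]; last by rewrite leye_eq.
  rewrite -EFinM -EFinB !lee_fin ler_nat => mC.
  rewrite lerBlDr ler_pdivrMl ?ltr0n // -natrD -natrM ler_nat.
  by nia.
case: (edistP (phi x) (phi y)) => [m w|_]; last first.
  by rewrite gt0_muley ?lte_fin ?ltr0n // addye // leey.
have r := reach_trans (reach_trans (gf1 x) (reach_walk psiC w)) (gf2 y).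
apply: le_trans (edist_reach r) _.
rewrite -EFinM -EFinD lee_fin -natrM -natrD ler_nat.
by nia.
Qed.

End QuasiIsometry.

(** * DL(q) and DL(q ^ s) are quasi-isometric *)

Section DLQuasiIsometry.
Variables (q s d : nat) (T : hom_tree q) (T' : hom_tree (q ^ s)).
Hypotheses (q_gt0 : (0 < q)%N) (s_gt0 : (0 < s)%N) (d_gt1 : (1 < d)%N).
Variables (par : T -> T) (par' : T' -> T').
Hypothesis adjE : forall x y : T, adj x y = (y == par x) || (x == par y).
Hypothesis adjE' : forall x y : T', adj x y = (y == par' x) || (x == par' y).
Hypothesis horoT : horotree q par (@busemann q T).
Hypothesis horoT' : horotree (q ^ s) par' (@busemann (q ^ s) T').
Local Open Scope ring_scope.

Let lpar := sublevel_par horoT (s := s).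
Let lhgt := @sublevel_hgt s T (@busemann q T).
Variables (f : sublevel s (@busemann q T) -> T') (g : T' -> sublevel s (@busemann q T)).
Hypotheses (fK : cancel f g) (gK : cancel g f).
Hypothesis f_par : forall x, f (lpar x) = par' (f x).
Hypothesis f_hgt : forall x, busemann (f x) = lhgt x.
Variable child : T' -> T'.
Hypothesis child_par : forall x, par' (child x) = x.

Let s_neq0 : s%:Z != 0. Proof. by rewrite eqz_nat -lt0n. Qed.

Lemma modz_nat_ex (h : int) : exists2 r : nat, (r < s)%N & (h %% s%:Z)%Z = r%:Z.
Proof.
have := modz_ge0 h s_neq0; have := ltz_pmod h (s_gt0 : 0 < s%:Z).
by case: (h %% s%:Z)%Z => // r; rewrite ltz_nat => rs _; exists r.
Qed.

Lemma floor_dvd (x : T) :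
  (s%:Z %| busemann (iter `|(busemann x %% s%:Z)%Z| par x))%Z.
Proof.
have [r _ hr] := modz_nat_ex (busemann x).
rewrite (hgt_iter horoT) hr {1}(divz_eq (busemann x) s%:Z) hr addrK.
exact: dvdz_mull.
Qed.

(** The nearest ancestor at a level divisible by [s]. *)
Definition floor (x : T) : sublevel s (@busemann q T) :=
  exist (fun x => is_true (s%:Z %| busemann x)%Z) _ (floor_dvd x).

Lemma floor_hgt x : busemann (f (floor x)) = (busemann x %/ s%:Z)%Z.
Proof.
rewrite f_hgt /lhgt /sublevel_hgt /= (hgt_iter horoT).
have [r _ hr] := modz_nat_ex (busemann x); rewrite hr.
by rewrite {1}(divz_eq (busemann x) s%:Z) hr addrK mulzK.
Qed.

Lemma cousins_floor x : cousins par s x (val (floor x)).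
Proof.
have [r rs hr] := modz_nat_ex (busemann x); rewrite /= hr.
by apply: cousins_weaken (ltnW rs) _; apply: cousins_iter.
Qed.

Lemma floor_sublevel (y : sublevel s (@busemann q T)) : floor (val y) = y.
Proof.
apply: val_inj; rewrite /=.
by have /dvdz_mod0P -> := svalP y.
Qed.

(** Rounding only skips to the next kept level when a kept level is left. *)
Lemma floor_par x : floor (par x) = floor x \/ floor (par x) = lpar (floor x).
Proof.
have [r rs hr] := modz_nat_ex (busemann x).
have hx := divz_eq (busemann x) s%:Z; rewrite hr in hx.
case: r => [|r] in rs hr hx.
  right; apply: val_inj; rewrite /= hr /=.
  have -> : (busemann (par x) %% s%:Z)%Z = s.-1%:Z.
    rewrite (hgt_par horoT) hx addr0.
    have -> : (busemann x %/ s%:Z)%Z * s%:Z - 1 =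
        ((busemann x %/ s%:Z)%Z - 1) * s%:Z + s.-1%:Z.
      by rewrite mulrBl mul1r; lia.
    by rewrite modzMDl modz_small //; lia.
  by rewrite /= -iterSr prednK.
left; apply: val_inj; rewrite /= hr.
have -> : (busemann (par x) %% s%:Z)%Z = r%:Z.
  rewrite (hgt_par horoT) hx.
  have -> : (busemann x %/ s%:Z)%Z * s%:Z + r.+1%:Z - 1 =
      (busemann x %/ s%:Z)%Z * s%:Z + r%:Z by lia.
  by rewrite modzMDl modz_small //; lia.
by rewrite /= -iterSr.
Qed.

Lemma cousins_floor_par x : cousins par' 1 (f (floor x)) (f (floor (par x))).
Proof.
have [->|->] := floor_par x; first exact: cousinsxx.
by rewrite f_par; apply: (cousins_iter par' 1).
Qed.

Lemma cousins_floor_adj (x y : T) : adj x y -> cousins par' 1 (f (floor x)) (f (floor y)).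
Proof.
rewrite adjE => /orP[/eqP->|/eqP->]; first exact: cousins_floor_par.
exact/cousins_sym/cousins_floor_par.
Qed.

Lemma g_iter m u : val (g (iter m par' u)) = iter (m * s) par (val (g u)).
Proof.
elim: m => //= m IHm.
by rewrite -[iter m par' u]gK -f_par fK /= IHm -iterD.
Qed.

Lemma cousins_g N u v : cousins par' N u v -> cousins par (N * s) (val (g u)) (val (g v)).
Proof.
move=> [m [n [mN nN uv]]]; exists (m * s)%N, (n * s)%N.
by rewrite !leq_mul2r mN nN !orbT -!g_iter uv.
Qed.

Let i0 := Ordinal (ltnW d_gt1).

(** What the coordinates lose in height by rounding down. *)
Definition deficit (x : DL d T) : nat :=
  absz (\sum_(i < d) (busemann (val x i) %/ s%:Z)%Z).

(** The deficit times [s] is a sum of [d] remainders modulo [s]. *)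
Lemma deficitP (x : DL d T) : (deficit x <= d)%N /\
  \sum_(i < d) (busemann (val x i) %/ s%:Z)%Z = - (deficit x)%:Z.
Proof.
set D := \sum_(i < d) _; set M := \sum_(i < d) (busemann (val x i) %% s%:Z)%Z.
have DM : D * s%:Z = - M.
  apply/eqP; rewrite -addr_eq0 mulr_suml -big_split /=; apply/eqP.
  rewrite -[RHS](eqP (valP x)); apply: eq_bigr => i _.
  exact/esym/divz_eq.
have M_ge0 : 0 <= M by apply: sumr_ge0 => i _; apply: modz_ge0.
have M_le : M <= d%:Z * s%:Z.
  have -> : d%:Z * s%:Z = \sum_(i < d) s%:Z.
    by rewrite sumr_const card_ord -mulr_natl natz.
  apply: ler_sum => i _; apply/ltW/ltz_pmod.
  by rewrite ltz_nat.
rewrite /deficit -/D; have s1 : 1 <= s%:Z by rewrite lez_nat.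
have D_le0 : D <= 0 by nia.
have : - D <= d%:Z by nia.
by lia.
Qed.

(** Rounded coordinates, the first of which descends to restore the total height. *)
Definition qi_fun (x : DL d T) : {ffun 'I_d -> T'} :=
  [ffun i => iter (if i == i0 then deficit x else 0%N) child (f (floor (val x i)))].

Lemma hgt_child m u : busemann (iter m child u) = busemann u + m%:Z.
Proof.
elim: m => [|m IHm] /=; first by rewrite addr0.
have := hgt_par horoT' (child (iter m child u)).
by rewrite child_par; lia.
Qed.

Lemma qi_fun_level (x : DL d T) : \sum_(i < d) busemann (qi_fun x i) == 0.
Proof.
have [_ dx] := deficitP x.
rewrite (eq_bigr (fun i => (busemann (val x i) %/ s%:Z)%Z
    + (if i == i0 then (deficit x)%:Z else 0))); last first.
  move=> i _; rewrite ffunE hgt_child floor_hgt.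
  by case: eqP.
by rewrite big_split /= dx -big_mkcond big_pred1_eq addNr.
Qed.

Definition qi_map (x : DL d T) : DL d T' :=
  exist (fun h : {ffun 'I_d -> T'} => is_true (\sum_i busemann (h i) == 0)) _
    (qi_fun_level x).

Lemma cousins_qi_map (x : DL d T) i :
  cousins par' d (f (floor (val x i))) (val (qi_map x) i).
Proof.
rewrite /= ffunE; have [dx _] := deficitP x.
apply: (@cousins_weaken _ _ (if i == i0 then deficit x else 0%N)).
  by case: eqP.
exact: cousins_descend.
Qed.

Lemma qi_inv_level (y : DL d T') :
  \sum_(i < d) busemann ([ffun i => val (g (val y i))] i) == 0 :> int.
Proof.
rewrite (eq_bigr (fun i => busemann (val y i) * s%:Z)).
  by rewrite -mulr_suml (eqP (valP y)) mul0r.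
by move=> i _; rewrite ffunE (@sublevel_hgtE s) -/lhgt -f_hgt gK.
Qed.

(** The inclusion of the kept levels. *)
Definition qi_inv (y : DL d T') : DL d T :=
  exist (fun h : {ffun 'I_d -> T} => is_true (\sum_i busemann (h i) == 0)) _
    (qi_inv_level y).

Lemma qi_invE y i : val (qi_inv y) i = val (g (val y i)).
Proof. by rewrite /= ffunE. Qed.

Lemma DL_adj_coord (e : nat) (U : hom_tree e) (P : U -> U -> Prop) (x y : DL d U) :
  (forall u, P u u) -> (forall u v, adj u v -> P u v) -> adj x y ->
  forall i, P (val x i) (val y i).
Proof.
move=> Pxx Padj /DL_adjP[i [j [_ xi xj xk]]] k.
have [->|ki] := eqVneq k i; first exact: Padj.
have [->|kj] := eqVneq k j; first exact: Padj.
by rewrite xk.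
Qed.

Lemma DL_quasi_isometric_of (R : realType) :
  quasi_isometric (@edist R (DL d T)) (@edist R (DL d T')).
Proof.
pose N := (d + 1 + d + s + d * s)%N.
have qs_gt0 : (0 < q ^ s)%N by rewrite expn_gt0 q_gt0.
have reachT := fun x y => @DL_cousins_reach q d T par q_gt0 adjE horoT N x y d_gt1.
have reachT' := fun x y =>
  @DL_cousins_reach (q ^ s) d T' par' qs_gt0 adjE' horoT' N x y d_gt1.
have weak (X : Type) (p : X -> X) M u v : (M <= N)%N -> cousins p M u v -> cousins p N u v.
  exact: cousins_weaken.
have gf (x : DL d T) i : cousins par N (val x i) (val (qi_inv (qi_map x)) i).
  apply: (@weak _ _ (s + d * s)%N); first by rewrite /N; lia.
  apply: cousins_trans (cousins_floor _) _.
  by have := cousins_g (cousins_qi_map x i); rewrite fK qi_invE.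
apply: (@quasi_isometric_lipschitz R _ _ qi_map qi_inv).
- move=> x y xy; apply: reachT' => i; apply: (@weak _ _ (d + 1 + d)%N).
    by rewrite /N; lia.
  have xyi : cousins par' 1 (f (floor (val x i))) (f (floor (val y i))).
    apply: (DL_adj_coord _ _ xy (P := fun u v => cousins par' 1 (f (floor u)) (f (floor v)))).
      by move=> u; apply: cousinsxx.
    exact: cousins_floor_adj.
  apply: cousins_trans (cousins_qi_map y i).
  by apply: cousins_trans xyi; apply/cousins_sym/cousins_qi_map.
- move=> x y xy; apply: reachT => i; apply: (@weak _ _ (1 * s)%N).
    by rewrite /N; lia.
  rewrite !qi_invE; apply: cousins_g.
  apply: (DL_adj_coord _ _ xy) => [u|u v]; first exact: cousinsxx.
  rewrite adjE' => /orP[/eqP->|/eqP->]; first exact: (cousins_iter par' 1).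
  exact/cousins_sym/(cousins_iter par' 1).
- by move=> x; apply: reachT.
- by move=> x; apply: reachT => i; apply: cousins_sym.
- move=> y; apply: reachT' => i; apply: (@weak _ _ d); first by rewrite /N; lia.
  by have := cousins_qi_map (qi_inv y) i; rewrite qi_invE floor_sublevel gK.
Qed.

End DLQuasiIsometry.

Theorem DL_quasi_isometric (R : realType) (q s d : nat) (T : hom_tree q)
    (T' : hom_tree (q ^ s)) : (0 < q)%N -> (0 < s)%N -> (1 < d)%N ->
  quasi_isometric (@edist R (DL d T)) (@edist R (DL d T')).
Proof.
move=> q_gt0 s_gt0 d_gt1.
have [par [adjE horoT]] := hom_tree_horotree T.
have [par' [adjE' horoT']] := hom_tree_horotree T'.
have qs_gt0 : (0 < q ^ s)%N by rewrite expn_gt0 q_gt0.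
have [f [g [fK gK f_par f_hgt]]] :=
  horotree_unique qs_gt0 (sublevel_horotree q_gt0 s_gt0 horoT) horoT'.
have /choice[child child_par] : forall x, exists y, par' y = x.
  by move=> x; have [y yx] := descendant_ex horoT' 1 x qs_gt0; exists y.
exact: (DL_quasi_isometric_of q_gt0 s_gt0 d_gt1 adjE adjE' horoT'
  fK gK f_par f_hgt child_par).
Qed.

(** * The tree of balls at a place *)

(** A neighbourhood [small] of [0], whose dilates by powers of [unif] are the
    balls at [0], together with representatives [digit] of a ball modulo the
    next smaller one. *)
Structure place (K : comUnitRingType) (A : finType) := Place {
  small : K -> Prop;
  unif : K;
  digit : A -> K;
  unif_unit : unif \is a GRing.unit;
  small0 : small 0%R;
  smallB : forall x y, small x -> small y -> small (x - y)%R;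
  small_unif : forall x, small x -> small (unif * x)%R;
  digit_small : forall a, small (unif * digit a)%R;
  digit_ex : forall x, small (unif * x)%R -> exists a, small (x - digit a)%R;
  digit_inj : forall a a', small (digit a - digit a')%R -> a = a';
  small_exhaust : forall x, exists m : nat, small (unif ^+ m * x)%R
}.

Section Balls.
Variables (K : comUnitRingType) (A : finType) (p : place K A).
Local Open Scope ring_scope.
Local Notation L := (small p).
Local Notation pi := (unif p).
Implicit Types (x y f : K) (k : int).

Lemma smallN x : L x -> L (- x).
Proof. by move=> Lx; rewrite -sub0r; apply: smallB => //; apply: small0. Qed.

Lemma smallD x y : L x -> L y -> L (x + y).
Proof. by move=> Lx Ly; rewrite -[y]opprK; apply/smallB/smallN. Qed.

Lemma small_sum (I : Type) (s : seq I) (P : pred I) (F : I -> K) :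
  (forall i, P i -> L (F i)) -> L (\sum_(i <- s | P i) F i).
Proof. by move=> LF; apply: big_ind => //; [apply: small0|apply: smallD]. Qed.

Lemma small_unifX m x : L x -> L (pi ^+ m * x).
Proof.
by elim: m => [|m IHm] Lx; rewrite ?mul1r // exprS -mulrA; apply/small_unif/IHm.
Qed.

Definition same_ball k f f' : Prop := L (pi ^ (- k) * (f - f')).

Lemma same_ball_refl k f : same_ball k f f.
Proof. by rewrite /same_ball subrr mulr0; apply: small0. Qed.

Lemma same_ball_sym k f f' : same_ball k f f' -> same_ball k f' f.
Proof. by rewrite /same_ball => /smallN; rewrite -mulrN opprB. Qed.

Lemma same_ball_trans k f g h : same_ball k f g -> same_ball k g h -> same_ball k f h.
Proof.
by rewrite /same_ball => fg gh; have := smallD fg gh; rewrite -mulrDr addrA subrK.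
Qed.

Lemma same_ball_pred k f f' : same_ball k f f' -> same_ball (k - 1) f f'.
Proof.
rewrite /same_ball opprB exprzDr ?unif_unit // expr1z -mulrA.
exact: small_unif.
Qed.

Lemma same_ball_exhaust f f' : exists N : nat, forall m : nat, (N <= m)%N ->
  same_ball (- m%:Z) f f'.
Proof.
have [N LN] := small_exhaust p (f - f'); exists N => m Nm.
rewrite /same_ball opprK -exprnP -(subnK Nm) exprD -mulrA.
exact: small_unifX.
Qed.

(** A ball remembers its level, which the underlying set need not determine. *)
Definition ball_spec (B : int * set K) : Prop :=
  exists f, B.2 = [set x | same_ball B.1 x f]%classic.

Definition ball_tree : Type := {B : int * set K | `[< ball_spec B >]}.

Lemma ballP k f : `[< ball_spec (k, [set x | same_ball k x f]%classic) >].
Proof. by apply/asboolP; exists f. Qed.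

Definition ball k f : ball_tree :=
  exist (fun B => is_true `[< ball_spec B >]) _ (ballP k f).

Definition level (B : ball_tree) : int := (val B).1.

Lemma ball_eq k f k' f' : ball k f = ball k' f' <-> k = k' /\ same_ball k f f'.
Proof.
split=> [[-> E]|[<- ff']].
  split=> //; have : [set x | same_ball k' x f]%classic f by exact: same_ball_refl.
  by rewrite E.
apply: val_inj; congr pair; apply/seteqP; split=> x /= xf.
  exact: same_ball_trans xf ff'.
exact/(same_ball_trans xf)/same_ball_sym.
Qed.

Lemma ball_ex (B : ball_tree) : exists f, B = ball (level B) f.
Proof.
case: B => [[k S] SP]; have /asboolP[f /= Sf] := SP.
by exists f; apply: val_inj; congr pair.
Qed.

Definition center (B : ball_tree) : K := projT1 (cid (ball_ex B)).

Lemma centerK (B : ball_tree) : ball (level B) (center B) = B.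
Proof. by rewrite /center; case: cid. Qed.

Definition ball_par (B : ball_tree) : ball_tree := ball (level B - 1) (center B).

Lemma ball_parE k f : ball_par (ball k f) = ball (k - 1) f.
Proof.
apply/ball_eq; split=> //; rewrite /level /=; apply: same_ball_pred.
by have /ball_eq[_] := centerK (ball k f).
Qed.

(** The balls of level [k + 1] inside the ball around [f] of level [k] are centred
    at the [f + unif ^ (k + 1) * digit a]. *)
Lemma ball_horotree : horotree #|A| ball_par level.
Proof.
split.
- by move=> B; rewrite -{1}(centerK B) ball_parE.
- move=> B; rewrite -(centerK B); move: (level B) (center B) => k f {B}.
  have pi_u : pi \is a GRing.unit := unif_unit p.
  pose c a := f + pi ^ (k + 1) * digit p a.
  apply: (@has_card_fin _ _ _ (fun a => ball (k + 1) (c a))).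
    move=> a a' /ball_eq[_]; rewrite /same_ball.
    have -> : c a - c a' = pi ^ (k + 1) * (digit p a - digit p a') by rewrite /c; ring.
    by rewrite mulrA -exprzDr // addNr mul1r; apply: digit_inj.
  move=> B; split; last first.
    move=> [a <-]; rewrite ball_parE addrK; apply/ball_eq; split=> //.
    rewrite /same_ball /c addrAC subrr add0r mulrA -exprzDr // addrA addNr add0r.
    exact: digit_small.
  rewrite -(centerK B) ball_parE; move: (level B) (center B) => k' f' {B}.
  case/ball_eq => kk' ff'; have k1 : k + 1 = k' by rewrite -kk' subrK.
  have [|a La] := @digit_ex _ _ p (pi ^ (- k') * (f' - f)).
    by rewrite mulrA -[X in L (X * _ * _)]expr1z -exprzDr // -opprB.
  exists a; apply/ball_eq; split=> //; rewrite k1.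
  apply: same_ball_sym; rewrite /same_ball /c k1.
  have -> : f' - (f + pi ^ k' * digit p a) = f' - f - pi ^ k' * digit p a by ring.
  by rewrite mulrBr [X in _ - X]mulrA -exprzDr // addNr mul1r.
- have iter_ball m k f : iter m ball_par (ball k f) = ball (k - m%:Z) f.
    elim: m => [|m /= ->]; first by rewrite subr0.
    by rewrite ball_parE; apply/ball_eq; split; [lia|apply: same_ball_refl].
  move=> B B'; rewrite -(centerK B) -(centerK B').
  move: (level B) (center B) (level B') (center B') => k f k' f' {B B'}.
  have [N Nf] := same_ball_exhaust f f'; pose M := (N + `|k| + `|k'|)%N.
  exists (absz (k + M%:Z)), (absz (k' + M%:Z)); rewrite !iter_ball; apply/ball_eq.
  split; first by rewrite /M; lia.
  have -> : k - (absz (k + M%:Z))%:Z = - M%:Z by rewrite /M; lia.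
  by apply: Nf; rewrite /M; lia.
- by exists (ball 0 0).
Qed.

(** By the uniqueness of the horotree, the vertices of [T] can be named by balls:
    [c k f] stands for the ball of level [k] around [f]. *)
Theorem place_tree (q : nat) (T : hom_tree q) : (0 < q)%N -> #|A| = q ->
  exists c : int -> K -> T,
    [/\ forall k f k' f', c k f = c k' f' <-> k = k' /\ same_ball k f f',
        forall v, exists k f, c k f = v,
        forall k f, busemann (c k f) = k &
        forall k f k' f', adj (c k f) (c k' f') <->
          (k' = k - 1 /\ same_ball k' f f') \/ (k = k' - 1 /\ same_ball k f f')].
Proof.
move=> q_gt0 Aq; have [par [adjE horoT]] := hom_tree_horotree T.
have horoB := ball_horotree; rewrite Aq in horoB.
have [i [i' [iK i'K i_par i_hgt]]] := horotree_unique q_gt0 horoB horoT.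
have cE k f k' f' : i (ball k f) = i (ball k' f') <-> k = k' /\ same_ball k f f'.
  by split=> [/(can_inj iK)/ball_eq|/ball_eq->].
exists (fun k f => i (ball k f)); split=> //.
- by move=> v; exists (level (i' v)), (center (i' v)); rewrite centerK i'K.
- move=> k f k' f' /=; rewrite adjE -!i_par !ball_parE; split.
    case/orP=> /eqP/cE[-> n]; [left|right]; split=> //.
    exact: same_ball_sym.
  case=> -[-> n]; apply/orP; [left|right]; apply/eqP/cE; split=> //.
  exact: same_ball_sym.
Qed.

End Balls.

(** * The places of the ring of the group *)

Section Places.
Variables (r : nat) (F : 'I_r.+1 -> finFieldType) (n : nat).
Variables (l : forall i, 'I_n -> F i) (Rd : localization (t_plus_ell l)).
Hypothesis l_inj : forall i, injective (l i).
Local Open Scope ring_scope.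
Implicit Types (w : seq 'I_n) (b : {poly prod_field F}) (x y : Rd).

Local Notation s := (t_plus_ell l).
Local Notation loc := (loc_map Rd).
Local Notation A := {dffun forall i : 'I_r.+1, F i}.

(** Denominators are written as words in the [s j], to be cleared one letter at a
    time. *)
Definition denom w : {poly prod_field F} := \prod_(j <- w) s j.

Lemma s_XsubC j : s j = 'X - (- ell l j)%:P.
Proof. by rewrite /t_plus_ell polyCN opprK. Qed.

Lemma denom_XsubC w : denom w = \prod_(j <- w) ('X - (- ell l j)%:P).
Proof. by apply: eq_bigr => j _; rewrite s_XsubC. Qed.

Lemma denom_monic w : denom w \is monic.
Proof. by rewrite denom_XsubC monic_prod_XsubC. Qed.

Lemma size_denom w : size (denom w) = (size w).+1.
Proof. by rewrite denom_XsubC size_prod_XsubC. Qed.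

Lemma denom_cat w w' : denom (w ++ w') = denom w * denom w'.
Proof. exact: big_cat. Qed.

Lemma denom_cons j w : denom (j :: w) = s j * denom w.
Proof. exact: big_cons. Qed.

Lemma denom_nil : denom [::] = 1.
Proof. exact: big_nil. Qed.

Lemma size_mul_denom b w : (size (b * denom w)%R <= size b + size w)%N.
Proof. by apply: leq_trans (size_polyMleq _ _) _; rewrite size_denom addnS. Qed.

Lemma size_mul_s b j : (size (b * s j)%R <= (size b).+1)%N.
Proof. by have := size_mul_denom b [:: j]; rewrite denom_cons denom_nil mulr1 addn1. Qed.

Lemma mul_denom_eq0 b w : b * denom w = 0 -> b = 0.
Proof.
move=> b0; apply/eqP; apply: contraT => b_neq0.
have := size_Mmonic b_neq0 (denom_monic w).
rewrite b0 size_poly0 size_denom addnS /=; move: b_neq0; rewrite -size_poly_gt0.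
by case: (size b).
Qed.

Lemma denom_prod (k : 'I_n -> nat) : exists w, denom w = \prod_(j < n) s j ^+ k j.
Proof.
exists (flatten [seq nseq (k j) j | j <- enum 'I_n]).
rewrite /denom big_flatten big_map big_enum; apply: eq_bigr => j _.
by rewrite big_nseq iter_mulr_1.
Qed.

Lemma loc_inj b : loc b = 0 -> b = 0.
Proof. by case/loc_ker => k; have [w <-] := denom_prod k; apply: mul_denom_eq0. Qed.

Lemma loc_eq b b' : loc b = loc b' -> b = b'.
Proof.
move=> bb'; apply/eqP; rewrite -subr_eq0; apply/eqP/loc_inj.
by rewrite rmorphB bb' subrr.
Qed.

Lemma loc_s_unit j : loc (s j) \is a GRing.unit.
Proof. exact: loc_unit. Qed.

Lemma loc_denom_unit w : loc (denom w) \is a GRing.unit.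
Proof.
elim: w => [|j w IHw]; first by rewrite denom_nil rmorph1 unitr1.
by rewrite denom_cons rmorphM unitrM loc_s_unit.
Qed.

Lemma loc_fraction x : exists w b, x * loc (denom w) = loc b.
Proof.
have [b [k ->]] := loc_frac x; have [w wk] := denom_prod k.
have -> : \prod_(j < n) loc (s j) ^+ k j = loc (denom w).
  by rewrite wk rmorph_prod; apply: eq_bigr => j _; rewrite rmorphXn.
by exists w, b; rewrite divrK ?loc_denom_unit.
Qed.

(** Distinct [l i j] make the differences of the [ell l j] invertible. *)
Lemma denom_eval_inv j w : j \notin w ->
  exists u : prod_field F, u * (denom w).[- ell l j] = 1.
Proof.
elim: w => [_|i w IHw].
  by exists 1; rewrite denom_nil hornerC mulr1.
rewrite inE negb_or => /andP[ji /IHw[u uw]].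
pose v : prod_field F := [ffun k => (l k i - l k j)^-1 : F k].
have vi : v * (s i).[- ell l j] = 1.
  rewrite hornerD hornerX hornerC; apply/ffunP => k; rewrite !ffunE.
  have lk : l k i - l k j != 0.
    by rewrite subr_eq0; apply: contraNneq ji => /l_inj ->.
  by rewrite [- _ + _]addrC mulVf.
exists (v * u); rewrite denom_cons hornerM.
by rewrite mulrACA vi uw mulr1.
Qed.

(** The field product has zero divisors, so cancellation needs an inverse. *)
Lemma denom_eval_reg j w (a : prod_field F) : j \notin w ->
  a * (denom w).[- ell l j] = 0 -> a = 0.
Proof.
case/denom_eval_inv => u uw aw.
by rewrite -[a]mulr1 -uw mulrCA mulrA [u * a]mulrC -mulrA mulrCA aw mulr0.
Qed.

Lemma root_factor j b : b.[- ell l j] = 0 -> exists b', b = b' * s j.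
Proof.
move/eqP/factor_theorem => [b' ->]; exists b'.
by rewrite s_XsubC.
Qed.

(** Fractions without a pole at [- ell l j]. *)
Definition fin_small (j : 'I_n) x : Prop :=
  exists w b, j \notin w /\ x * loc (denom w) = loc b.

(** Fractions of negative degree. *)
Definition inf_small x : Prop :=
  exists w b, (size b <= size w)%N /\ x * loc (denom w) = loc b.

Lemma fin_small_loc j b : fin_small j (loc b).
Proof. by exists [::], b; rewrite denom_nil rmorph1 mulr1. Qed.

Lemma inf_small0 : inf_small 0.
Proof. by exists [::], 0; rewrite size_poly0 mul0r rmorph0. Qed.

Lemma fracB x y w b w' b' : x * loc (denom w) = loc b ->
  y * loc (denom w') = loc b' ->
  (x - y) * loc (denom (w ++ w')) = loc (b * denom w' - b' * denom w).
Proof.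
move=> xb yb; rewrite denom_cat mulrBl rmorphB !rmorphM -xb -yb.
by congr (_ - _); ring.
Qed.

Lemma fin_smallB j x y :
  fin_small j x -> fin_small j y -> fin_small j (x - y).
Proof.
move=> [w [b [jw xb]]] [w' [b' [jw' yb]]].
exists (w ++ w'), (b * denom w' - b' * denom w).
by rewrite mem_cat negb_or jw jw' (fracB xb yb).
Qed.

Lemma inf_smallB x y :
  inf_small x -> inf_small y -> inf_small (x - y).
Proof.
move=> [w [b [bw xb]]] [w' [b' [bw' yb]]].
exists (w ++ w'), (b * denom w' - b' * denom w).
rewrite (fracB xb yb); split=> //; rewrite size_cat.
apply: leq_trans (size_polyD _ _) _; rewrite size_polyN geq_max.
apply/andP; split; apply: leq_trans (size_mul_denom _ _) _.
  by rewrite leq_add2r.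
by rewrite addnC leq_add2l.
Qed.

Lemma fin_smallM_s j i x : fin_small j x -> fin_small j (loc (s i) * x).
Proof.
move=> [w [b [jw xb]]]; exists w, (s i * b); split=> //.
by rewrite rmorphM -mulrA xb.
Qed.

Lemma fin_smallV_s j i x : i != j -> fin_small j x ->
  fin_small j ((loc (s i))^-1 * x).
Proof.
move=> ij [w [b [jw xb]]]; exists (i :: w), b.
rewrite inE negb_or eq_sym ij denom_cons rmorphM; split=> //.
by rewrite mulrAC mulrA mulVr ?loc_s_unit // mul1r mulrC.
Qed.

Lemma inf_smallV_s i x : inf_small x -> inf_small ((loc (s i))^-1 * x).
Proof.
move=> [w [b [bw xb]]]; exists (i :: w), b; split; first by rewrite ltnW.
by rewrite denom_cons rmorphM mulrAC mulrA mulVr ?loc_s_unit // mul1r mulrC.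
Qed.

Lemma inf_small_ratio i j x :
  inf_small x -> inf_small ((loc (s j))^-1 * (loc (s i) * x)).
Proof.
move=> [w [b [bw xb]]]; exists (j :: w), (b * s i); split.
  by apply: leq_trans (size_mul_s _ _) _.
rewrite denom_cons !rmorphM -xb.
rewrite -[RHS]mul1r -(mulVr (loc_s_unit j)).
by move: (loc (s j))^-1 => t; ring.
Qed.

Lemma fin_pole j : ~ fin_small j (loc (s j))^-1.
Proof.
move=> [w [b [jw wb]]].
have dw : denom w = s j * b.
  by apply: loc_eq; rewrite rmorphM -wb mulrA divrr ?loc_s_unit ?mul1r.
have : (1 : prod_field F) = 0.
  apply: (@denom_eval_reg j w) => //; rewrite mul1r dw hornerM.
  by rewrite s_XsubC hornerXsubC subrr mul0r.
by move/eqP; rewrite oner_eq0.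
Qed.

(** The digit is the value at [- ell l j] of the numerator over that of the
    denominator. *)
Lemma fin_digit_ex j x : fin_small j (loc (s j) * x) ->
  exists a : prod_field F, fin_small j (x - (loc (s j))^-1 * loc a%:P).
Proof.
move=> [w [b [jw xb]]]; have [u uw] := denom_eval_inv jw.
have [a [b' bE]] : exists a, exists b', b - a%:P * denom w = b' * s j.
  exists (b.[- ell l j] * u); apply: root_factor.
  by rewrite hornerD hornerN hornerM hornerC -mulrA uw mulr1 subrr.
exists a, w, b'; split=> //.
apply: (@mulIr _ (loc (s j))); first exact: loc_s_unit.
rewrite -rmorphM -bE rmorphB -xb [loc (_ * _)]rmorphM.
rewrite -[loc a%:P * _]mul1r -(mulVr (loc_s_unit j)).
by move: (loc (s j)) (loc (s j))^-1 (loc a%:P) (loc (denom w)) => t t' c D; ring.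
Qed.

Lemma fin_digit_inj j (a a' : prod_field F) :
  fin_small j ((loc (s j))^-1 * loc a%:P
                  - (loc (s j))^-1 * loc a'%:P) -> a = a'.
Proof.
move=> [w [b [jw xb]]]; apply/eqP; rewrite -subr_eq0; apply/eqP.
apply: (@denom_eval_reg j w) => //.
suff -> : (a - a') * (denom w).[- ell l j]
    = (s j * b).[- ell l j].
  by rewrite hornerM s_XsubC hornerXsubC subrr mul0r.
rewrite -[X in X * _](hornerC _ (- ell l j)) -hornerM; congr horner.
apply: loc_eq; rewrite !rmorphM -xb -mulrBr !mulrA divrr ?loc_s_unit // mul1r.
by rewrite polyCB rmorphB.
Qed.

Lemma fin_exhaust j x : exists m, fin_small j (loc (s j) ^+ m * x).
Proof.
have [w [b]] := loc_fraction x; elim: w x => [|i w IHw] x.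
  rewrite denom_nil rmorph1 mulr1 => ->; exists 0%N; rewrite mul1r.
  exact: fin_small_loc.
rewrite denom_cons rmorphM mulrA => /IHw[m Lm].
have [ij|ij] := eqVneq i j.
  by rewrite ij in Lm; exists m.+1; rewrite exprSr -mulrA [loc (s j) * x]mulrC.
exists m; have := fin_smallV_s ij Lm.
by rewrite [x * loc (s i)]mulrC mulrCA mulKr ?loc_s_unit.
Qed.

Definition fin_place (j : 'I_n) : place Rd A.
Proof.
apply: (@Place Rd A (fin_small j) (loc (s j))
  (fun a : A => (loc (s j))^-1 * loc (a : prod_field F)%:P)).
- exact: loc_s_unit.
- by rewrite -(rmorph0 loc); apply: fin_small_loc.
- exact: fin_smallB.
- exact: fin_smallM_s.
- by move=> a; rewrite mulVKr ?loc_s_unit //; apply: fin_small_loc.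
- exact: fin_digit_ex.
- exact: fin_digit_inj.
- exact: fin_exhaust.
Defined.

Variable o : 'I_n.
Let so_unit : loc (s o) \is a GRing.unit := loc_s_unit o.

Lemma inf_digit_small (a : prod_field F) :
  inf_small ((loc (s o))^-1 * loc a%:P).
Proof.
exists [:: o], a%:P; split; first by rewrite size_polyC leq_b1.
by rewrite denom_cons denom_nil mulr1 mulrAC mulVr // mul1r.
Qed.

(** The digit is the coefficient of degree zero in the expansion at infinity. *)
Lemma inf_digit_ex x : inf_small ((loc (s o))^-1 * x) ->
  exists a : prod_field F, inf_small (x - loc a%:P).
Proof.
move=> [w [b [bw xb]]]; pose c := b * s o.
have [a aE] : exists a, a = c`_(size w) by exists c`_(size w).
have xc : x * loc (denom w) = loc c.
  rewrite /c rmorphM -xb -[LHS]mul1r -(mulVr so_unit).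
  by move: (loc (s o)) (loc (s o))^-1 (loc (denom w)) => t t' D; ring.
exists a, w, (c - a%:P * denom w); split; last first.
  by rewrite mulrBl xc -rmorphM -rmorphB.
apply/leq_sizeP => i; rewrite leq_eqVlt => /predU1P[<-|wi].
  rewrite coefB coefCM.
  have -> : (denom w)`_(size w) = 1.
    by have /monicP := denom_monic w; rewrite /lead_coef size_denom.
  by rewrite mulr1 aE subrr.
rewrite coefB coefCM !nth_default ?mulr0 ?subr0 // ?size_denom //.
by apply: leq_trans (size_mul_s _ _) _; apply: leq_ltn_trans wi.
Qed.

Lemma inf_digit_inj (a a' : prod_field F) :
  inf_small (loc a%:P - loc a'%:P) -> a = a'.
Proof.
move=> [w [b [bw xb]]]; apply/eqP; rewrite -subr_eq0; apply/eqP.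
have bE : b = (a - a')%:P * denom w.
  by apply: loc_eq; rewrite -xb rmorphM polyCB rmorphB.
have : b`_(size w) = 0 by rewrite nth_default.
rewrite bE coefCM.
have -> : (denom w)`_(size w) = 1.
  by have /monicP := denom_monic w; rewrite /lead_coef size_denom.
by rewrite mulr1.
Qed.

Lemma inf_exhaust x : exists m, inf_small ((loc (s o))^-1 ^+ m * x).
Proof.
have [w [b]] := loc_fraction x; elim: w x => [|i w IHw] x.
  rewrite denom_nil rmorph1 mulr1 => ->; exists (size b), (nseq (size b) o), b.
  rewrite size_nseq; split=> //.
  rewrite /denom big_nseq iter_mulr_1 rmorphXn mulrAC -exprMn mulVr //.
  by rewrite expr1n mul1r.
rewrite denom_cons rmorphM mulrA => /IHw[m Lm]; exists m.
have := inf_smallV_s i Lm.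
by rewrite [x * loc (s i)]mulrC mulrCA mulKr ?loc_s_unit.
Qed.

Definition inf_place : place Rd A.
Proof.
apply: (@Place Rd A inf_small (loc (s o))^-1
  (fun a : A => loc (a : prod_field F)%:P)).
- by rewrite unitrV.
- exact: inf_small0.
- exact: inf_smallB.
- exact: inf_smallV_s.
- exact: inf_digit_small.
- exact: inf_digit_ex.
- exact: inf_digit_inj.
- exact: inf_exhaust.
Defined.

(** Without poles the letters of the denominator cancel one by one, and negative
    degree leaves only the zero polynomial. *)
Lemma small_everywhere x :
  (forall j, fin_small j x) -> inf_small x -> x = 0.
Proof.
move=> xj [w [b [+ xb]]]; elim: w b xb => [|j w IHw] b xb.
  rewrite leqn0 size_poly_eq0 => /eqP b0.
  by move: xb; rewrite b0 denom_nil rmorph0 rmorph1 mulr1.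
move=> bw; have [|b' bE] := @root_factor j b.
  have [w' [c [jw' xc]]] := xj j; apply: (@denom_eval_reg j w') => //.
  rewrite -hornerM; have -> : b * denom w' = c * denom (j :: w).
    by apply: loc_eq; rewrite !rmorphM -xb -xc mulrAC.
  by rewrite hornerM denom_cons hornerM s_XsubC hornerXsubC subrr mul0r mulr0.
apply: (IHw b').
  apply: (@mulIr _ (loc (s j))); first exact: loc_s_unit.
  by rewrite -rmorphM -bE -xb denom_cons rmorphM mulrA [RHS]mulrAC.
have [->|b'0] := eqVneq b' 0; first by rewrite size_poly0.
move: bw; rewrite bE s_XsubC size_Mmonic ?monicXsubC // size_XsubC.
by rewrite addn2.
Qed.

End Places.

(** * The group acts simply transitively on the product *)

Section Stabiliser.
Variables (K : comUnitRingType) (A : finType) (p : place K A).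
Local Open Scope ring_scope.
Implicit Types w x : K.

(** Multiplication by [w] preserves the balls at [0]. *)
Definition stab w : Prop :=
  w \is a GRing.unit /\ forall x, small p (w * x) <-> small p x.

Lemma stab1 : stab 1.
Proof. by split=> [|x]; rewrite ?unitr1 // mul1r. Qed.

Lemma stabM w w' : stab w -> stab w' -> stab (w * w').
Proof.
move=> [wu sw] [wu' sw']; split=> [|x]; first by rewrite unitrM wu.
by rewrite -mulrA sw sw'.
Qed.

Lemma stabV w : stab w -> stab w^-1.
Proof.
move=> [wu sw]; split=> [|x]; first by rewrite unitrV.
by rewrite -sw mulVKr.
Qed.

Lemma stabX w (m : nat) : stab w -> stab (w ^+ m).
Proof.
by move=> sw; elim: m => [|m IHm]; [apply: stab1 | rewrite exprS; apply: stabM].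
Qed.

Lemma stabz w (k : int) : stab w -> stab (w ^ k).
Proof. by move=> sw; case: k => m; [apply: stabX | apply/stabV/stabX]. Qed.

Lemma stab_prod (I : finType) (P : pred I) (W : I -> K) :
  (forall i, P i -> stab (W i)) -> stab (\prod_(i | P i) W i).
Proof. by move=> sW; apply: big_ind => //; [apply: stab1 | apply: stabM]. Qed.

End Stabiliser.

Section Action.
Variables (r : nat) (F : 'I_r.+1 -> finFieldType) (m : nat).
Variables (l : forall i, 'I_m.+1 -> F i) (Rd : localization (t_plus_ell l)).
Hypothesis l_inj : forall i, injective (l i).
Local Open Scope ring_scope.
Local Notation A := {dffun forall i : 'I_r.+1, F i}.
Local Notation s := (t_plus_ell l).
Local Notation loc := (loc_map Rd).
Local Notation U := (unit_monomial Rd).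
Implicit Types (k : 'I_m.+1 -> int) (j : 'I_m.+2) (x P : Rd).

(** Index [0] is the place at infinity, the others are the zeros of the [s i]. *)
Definition places j : place Rd A :=
  if unlift ord0 j is Some i then fin_place Rd l_inj i else inf_place Rd ord0.

Definition valuation k j : int :=
  if unlift ord0 j is Some i then k i else - \sum_i k i.

Lemma valuation_lift k i : valuation k (lift ord0 i) = k i.
Proof. by rewrite /valuation liftK. Qed.

Lemma valuation_sum k : \sum_j valuation k j = 0.
Proof.
rewrite big_ord_recl [X in X + _]/valuation unlift_none.
have -> : \sum_i valuation k (lift ord0 i) = \sum_i k i.
  by apply: eq_bigr => i _; rewrite valuation_lift.
exact: addNr.
Qed.

Lemma valuationD k k' j :
  valuation (fun i => k i + k' i) j = valuation k j + valuation k' j.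
Proof.
rewrite /valuation; case: (unlift ord0 j) => //.
by rewrite big_split opprD.
Qed.

(** The monomial is the power [valuation k j] of the uniformizer times a product
    of powers of [s i'], or of ratios of two of them at infinity, that preserve
    the balls. *)
Lemma stab_unit_monomial k j :
  stab (places j) (unif (places j) ^ (- valuation k j) * U k).
Proof.
have fin_stab i i' : i' != i -> stab (fin_place Rd l_inj i) (loc (s i')).
  move=> ii'; split=> [|x]; first exact: loc_s_unit.
  split=> [/(fin_smallV_s ii')|]; last exact: fin_smallM_s.
  by rewrite mulKr ?loc_s_unit.
have inf_stab i : stab (inf_place Rd ord0) ((loc (s ord0))^-1 * loc (s i)).
  split=> [|x]; first by rewrite unitrM unitrV !loc_s_unit.
  split=> [|Lx]; last by rewrite -mulrA; apply: inf_small_ratio.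
  move/(inf_small_ratio ord0 i).
  by rewrite -mulrA mulVKr ?loc_s_unit // mulKr ?loc_s_unit.
rewrite /places /valuation; case: unliftP => [i|] _ /=.
  rewrite /unit_monomial (bigD1 i) //= mulrA -exprzDr ?loc_s_unit // addNr mul1r.
  by apply: stab_prod => i' ii'; apply/stabz/fin_stab.
rewrite opprK (big_morph (fun a : int => (loc (s ord0))^-1 ^ a)
  (id1 := 1) (op1 := *%R)) //; last first.
  by move=> a b; rewrite exprzDr // unitrV loc_s_unit.
rewrite -big_split; apply: stab_prod => i _ /=.
rewrite -exprMz_comm ?unitrV ?loc_s_unit //; last exact: mulrC.
exact/stabz/inf_stab.
Qed.

Lemma unit_monomial_unit k : U k \is a GRing.unit.
Proof.
have [+ _] := stab_unit_monomial k ord0.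
by rewrite unitrM => /andP[].
Qed.

(** Otherwise the inverse of [s i] would have no pole at the zero of [s i]. *)
Lemma fin_unif_unstable i (e : int) :
  stab (fin_place Rd l_inj i) (loc (s i) ^ e) -> e = 0.
Proof.
have t_u : loc (s i) \is a GRing.unit by apply: loc_s_unit.
have pos (a : nat) : stab (fin_place Rd l_inj i) (loc (s i) ^+ a.+1) -> False.
  move=> [_ st]; apply: (@fin_pole r F m.+1 l Rd l_inj i).
  have -> : (loc (s i))^-1 = loc (s i) ^+ a * (loc (s i) ^+ a.+1)^-1.
    by rewrite -exprVn exprSr mulrA -exprMn divrr // expr1n mul1r.
  apply: (@small_unifX _ _ (fin_place Rd l_inj i)); apply/st.
  rewrite divrr ?unitrX // -(rmorph1 loc); exact: fin_small_loc.
case: e => [[|a]|a] //; first by move/pos.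
by move/stabV; rewrite /exprz invrK => /pos.
Qed.

Lemma unit_monomial_inj k k' : U k = U k' -> k = k'.
Proof.
move=> kk'; apply/funext => i; pose j := lift ord0 i.
have := stab_unit_monomial k j; have := stab_unit_monomial k' j.
rewrite -kk' !valuation_lift /places /j liftK [unif _]/= => s1 s2.
have /fin_unif_unstable : stab (fin_place Rd l_inj i) (loc (s i) ^ (k i - k' i)).
  have -> : loc (s i) ^ (k i - k' i) =
      (loc (s i) ^ (- k' i) * U k) * (loc (s i) ^ (- k i) * U k)^-1.
    apply: (@mulIr _ (loc (s i) ^ (- k i) * U k)); first by case: s2.
    rewrite divrK; last by case: s2.
    by rewrite mulrA -exprzDr ?loc_s_unit //; congr (_ ^ _ * _); lia.
  exact/stabM/stabV.
by lia.
Qed.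

(** The digits expand an element at one place by elements small at all others. *)
Lemma places_disjoint j j' (a : A) (e : nat) : j' != j ->
  small (places j') ((unif (places j))^-1 ^+ e * digit (places j) a).
Proof.
have iter (L : Rd -> Prop) t : (forall x, L x -> L (t * x)) ->
    forall x, L x -> L (t ^+ e * x).
  move=> Lt x Lx; elim: e => [|c IHc]; first by rewrite mul1r.
  by rewrite exprS -mulrA; apply: Lt.
rewrite /places; case: unliftP => [i'|] ->; case: unliftP => [i|] -> jj' /=.
- have ii' : i != i' by rewrite eq_sym -(inj_eq (@lift_inj _ ord0)).
  apply: iter; first by move=> x; apply: fin_smallV_s.
  exact/fin_smallV_s/fin_small_loc.
- apply: iter; last exact: fin_small_loc.
  by move=> x; rewrite invrK; apply: fin_smallM_s.
- apply: iter; last exact: inf_digit_small.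
  exact: inf_smallV_s.
- by rewrite eqxx in jj'.
Qed.

(** Subtract digits one at a time. *)
Lemma polar_part j x :
  exists2 y, small (places j) (x - y) &
    forall j', j' != j -> small (places j') y.
Proof.
have [e] := small_exhaust (places j) x; elim: e x => [|e IHe] x.
  rewrite mul1r => Lx; exists 0; first by rewrite subr0.
  by move=> j' _; apply: small0.
rewrite exprS -mulrA => /digit_ex[a La].
have [|y Ly yj] := IHe (x - (unif (places j))^-1 ^+ e * digit (places j) a).
  rewrite mulrBr mulrA -exprMn divrr ?unif_unit // expr1n mul1r.
  exact: La.
exists (y + (unif (places j))^-1 ^+ e * digit (places j) a).
  by rewrite opprD addrA addrAC.
by move=> j' j'j; apply: smallD; [apply: yj | apply: places_disjoint].
Qed.

(** Partial fractions: the principal parts can be prescribed independently. *)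
Lemma partial_fractions (f : 'I_m.+2 -> Rd) :
  exists x, forall j, small (places j) (x - f j).
Proof.
have /choice[y yP] : forall j, exists y, [/\ small (places j) (f j - y) &
    forall j', j' != j -> small (places j') y].
  by move=> j; have [y] := polar_part j (f j); exists y.
exists (\sum_j y j) => j; rewrite (bigD1 j) //= addrAC.
apply: smallD; first by rewrite -opprB; apply: smallN; case: (yP j).
apply: small_sum => j' j'j; have [_] := yP j'; apply.
by rewrite eq_sym.
Qed.

Lemma places_trivial x : (forall j, small (places j) x) -> x = 0.
Proof.
move=> Lx; apply: (small_everywhere l_inj) => [i|].
  by have := Lx (lift ord0 i); rewrite /places liftK.
by have := Lx ord0; rewrite /places unlift_none.
Qed.

Lemma same_ball_act k0 P0 j (a : int) x y :
  same_ball (places j) (valuation k0 j + a) (U k0 * x + P0) (U k0 * y + P0) <->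
  same_ball (places j) a x y.
Proof.
have [_ st] := stab_unit_monomial k0 j; rewrite /same_ball.
rewrite -(st (unif (places j) ^ (- a) * (x - y))) opprD exprzDr ?unif_unit //.
move: (unif _ ^ (- valuation k0 j)) (unif _ ^ (- a)) (U k0) => t t' u.
by have -> : t * t' * (u * x + P0 - (u * y + P0)) = t * u * (t' * (x - y)) by ring.
Qed.

Section Product.
Variables (q : nat) (T : hom_tree q) (q_gt0 : (0 < q)%N).
Variable c : 'I_m.+2 -> int -> Rd -> T.
Hypothesis c_eq : forall j a x b y,
  c j a x = c j b y <-> a = b /\ same_ball (places j) a x y.
Hypothesis c_surj : forall j v, exists a x, c j a x = v.
Hypothesis c_hgt : forall j a x, busemann (c j a x) = a.
Hypothesis c_adj : forall j a x b y, adj (c j a x) (c j b y) <->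
  (b = a - 1 /\ same_ball (places j) b x y) \/ (a = b - 1 /\ same_ball (places j) a x y).

Lemma vertex_of_level k P :
  \sum_j busemann ([ffun j => c j (valuation k j) P] j) == 0.
Proof.
rewrite (eq_bigr (valuation k)) ?valuation_sum //.
by move=> j _; rewrite ffunE c_hgt.
Qed.

(** The image, under the affine map with linear part [U k] and translation [P], of
    the vertex whose balls are the neighbourhoods [small]. *)
Definition vertex_of k P : DL m.+2 T :=
  exist (fun f : {ffun 'I_m.+2 -> T} => is_true (\sum_j busemann (f j) == 0)) _
    (vertex_of_level k P).

Lemma vertex_ofE k P j : val (vertex_of k P) j = c j (valuation k j) P.
Proof. by rewrite /= ffunE. Qed.

Lemma vertex_of_inj k P k' P' : vertex_of k P = vertex_of k' P' -> k = k' /\ P = P'.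
Proof.
move=> E; have Ej j : valuation k j = valuation k' j /\
    same_ball (places j) (valuation k j) P P'.
  by apply/c_eq; rewrite -!vertex_ofE E.
split.
  by apply/funext => i; have [+ _] := Ej (lift ord0 i); rewrite !valuation_lift.
have : (U k)^-1 * (P - P') = 0.
  apply: places_trivial => j; have [_ st] := stab_unit_monomial k j.
  apply/st; rewrite -mulrA mulVKr ?unit_monomial_unit //.
  by have [] := Ej j.
move=> /(congr1 ( *%R (U k))); rewrite mulVKr ?unit_monomial_unit // mulr0.
exact: subr0_eq.
Qed.

(** Dividing by the monomial with the prescribed valuations reduces to balls of
    level zero, which contain a common point by partial fractions. *)
Lemma vertex_of_surj (z : DL m.+2 T) : exists k P, vertex_of k P = z.
Proof.
have /choice[a aP] := fun j => c_surj j (val z j).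
have /choice[f fP] := aP.
pose k i := a (lift ord0 i).
have kE j : valuation k j = a j.
  rewrite /valuation; case: unliftP => [i|] -> //.
  have := eqP (valP z); rewrite (eq_bigr a); last first.
    by move=> j' _; rewrite -fP c_hgt.
  by rewrite big_ord_recl => /eqP; rewrite addr_eq0 => /eqP ->.
have [x xP] := partial_fractions (fun j => (U k)^-1 * f j).
exists k, (U k * x); apply: val_inj; apply/ffunP => j; rewrite vertex_ofE -fP kE.
apply/c_eq; split=> //; have [_ st] := stab_unit_monomial k j.
have := xP j; rewrite -st kE -mulrA mulrBr mulVKr ?unit_monomial_unit //.
Qed.

Lemma vertex_of_adj k0 P0 k P k' P' :
  adj (vertex_of (fun i => k0 i + k i) (U k0 * P + P0))
      (vertex_of (fun i => k0 i + k' i) (U k0 * P' + P0)) =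
  adj (vertex_of k P) (vertex_of k' P').
Proof.
have act_eq j : c j (valuation (fun i => k0 i + k i) j) (U k0 * P + P0) =
    c j (valuation (fun i => k0 i + k' i) j) (U k0 * P' + P0) <->
    c j (valuation k j) P = c j (valuation k' j) P'.
  rewrite !c_eq !valuationD same_ball_act.
  by split=> -[E n]; split=> //; [apply: addrI E|rewrite E].
have act_adj j : adj (c j (valuation (fun i => k0 i + k i) j) (U k0 * P + P0))
    (c j (valuation (fun i => k0 i + k' i) j) (U k0 * P' + P0)) =
    adj (c j (valuation k j) P) (c j (valuation k' j) P').
  apply/idP/idP; rewrite !c_adj !valuationD !same_ball_act;
    by case=> -[E n]; [left|right]; split=> //; lia.
apply/DL_adjP/DL_adjP => -[i [j [ij ai aj E]]]; exists i, j;
  move: ai aj; rewrite !vertex_ofE !act_adj => ai aj; split=> // e ei ej;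
  by have := E e ei ej; rewrite !vertex_ofE; apply act_eq.
Qed.

End Product.

End Action.

(** * DL(Q) as a Cayley graph *)

Lemma DL_locally_finite (q d : nat) (T : hom_tree q) (x : DL d T) :
  exists S : seq (DL d T), forall y, adj x y -> y \in S.
Proof.
have /choice[K KP] : forall u : T, exists K : seq T, forall v, adj u v -> v \in K.
  move=> u; have : finite_set [set v | adj u v]%classic.
    by apply/finite_setP; exists q.+1; apply: hom_tree_degree.
  by case/finite_seqP => K KE; exists K => v uv; have : [set` K]%classic v by rewrite -KE.
pose L i := val x i :: K (val x i); pose N := (\max_i size (L i))%N.
have y_at (y : DL d T) : adj x y -> exists m : {ffun 'I_d -> 'I_N.+1},
    forall i, val y i = nth (val x i) (L i) (m i).
  case/DL_adjP => i [j [_ xi xj xk]].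
  have yL k : val y k \in L k.
    rewrite inE; have [->|ki] := eqVneq k i; first by rewrite KP ?orbT.
    have [->|kj] := eqVneq k j; first by rewrite KP ?orbT.
    by rewrite xk ?eqxx.
  have idx_lt k : (index (val y k) (L k) < N.+1)%N.
    by rewrite ltnS (leq_trans (index_size _ _)) // /N leq_bigmax.
  exists [ffun k => Ordinal (idx_lt k)] => k.
  by rewrite ffunE nth_index.
pose pick_y (m : {ffun 'I_d -> 'I_N.+1}) : DL d T :=
  if pselect (exists y : DL d T, forall i, val y i = nth (val x i) (L i) (m i)) is left h
  then projT1 (cid h) else x.
exists [seq pick_y m | m <- enum {: {ffun 'I_d -> 'I_N.+1}}] => y /y_at[m ym].
apply/mapP; exists m; rewrite ?mem_enum // /pick_y.
case: pselect => [h|[]]; last by exists y.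
case: cid => z /= zm; apply: val_inj; apply/ffunP => i.
by rewrite ym zm.
Qed.

Section Cayley.
Variables (r : nat) (F : 'I_r.+1 -> finFieldType) (m : nat).
Variables (l : forall i, 'I_m.+1 -> F i) (Rd : localization (t_plus_ell l)).
Hypothesis l_inj : forall i, injective (l i).
Variables (q : nat) (T : hom_tree q).
Hypothesis q_gt0 : (0 < q)%N.
Hypothesis card_q : #|{dffun forall i : 'I_r.+1, F i}| = q.
Local Open Scope ring_scope.
Local Notation U := (unit_monomial Rd).
Local Notation G := (Gamma Rd).

Lemma affine_mx_inj (a b a' b' : Rd) :
  affine_mx a b = affine_mx a' b' -> a = a' /\ b = b'.
Proof.
by move=> /matrixP E; split; [have := E ord0 ord0 | have := E ord0 ord_max];
  rewrite !mxE.
Qed.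

Lemma Gamma_rep (g : G) : exists kP : ('I_m.+1 -> int) * Rd,
  val g = affine_mx (U kP.1) kP.2.
Proof. by have /asboolP[k [P gE]] := svalP g; exists (k, P). Qed.

Lemma affine_is_Gamma (k : 'I_m.+1 -> int) (P : Rd) :
  `[< is_Gamma_mx (affine_mx (U k) P) >].
Proof. by apply/asboolP; exists k, P. Qed.

(** The orbit map of the base vertex; equivariance holds because an affine map
    preserves the relation of lying in a common ball of the shifted level. *)
Lemma Gamma_orbit : exists Phi : G -> DL m.+2 T,
  bijective Phi /\ forall g x y : G,
    adj (Phi (g * x)%g) (Phi (g * y)%g) = adj (Phi x) (Phi y).
Proof.
have /choice[c cP] := fun j => place_tree (places Rd l_inj j) T q_gt0 card_q.
have c_eq j a x b y := let: And4 h _ _ _ := cP j in h a x b y.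
have c_surj j := let: And4 _ h _ _ := cP j in h.
have c_hgt j := let: And4 _ _ h _ := cP j in h.
have c_adj j a x b y := let: And4 _ _ _ h := cP j in h a x b y.
have /choice[rep repE] := Gamma_rep.
pose Phi g := vertex_of c_hgt (rep g).1 (rep g).2.
exists Phi; split.
  have /choice[Psi PsiK] : forall z, exists g, Phi g = z.
    move=> z; have [k [P <-]] := vertex_of_surj c_eq c_surj c_hgt z.
    pose g : G := exist (fun M => is_true `[< is_Gamma_mx M >]) _ (affine_is_Gamma k P).
    exists g; have [/(unit_monomial_inj l_inj) kE PE] := affine_mx_inj (esym (repE g)).
    by rewrite /Phi -kE -PE.
  exists Psi => [g|]; last exact: PsiK.
  have [kE PE] := vertex_of_inj c_eq (PsiK (Phi g)).
  by apply: val_inj; rewrite !repE kE PE.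
move=> g x y.
have repM h : (rep (g * h)%g).1 = (fun i => (rep g).1 i + (rep h).1 i) /\
    (rep (g * h)%g).2 = U (rep g).1 * (rep h).2 + (rep g).2.
  have : val (g * h)%g = val g * val h by [].
  rewrite !repE affine_mxM unit_monomialM => /affine_mx_inj[/(unit_monomial_inj l_inj)].
  by [].
have [kx Px] := repM x; have [ky Py] := repM y.
by rewrite /Phi kx Px ky Py; apply: vertex_of_adj.
Qed.

(** The generators are the elements that move the base vertex to a neighbour. *)
Theorem DL_cayley : is_cayley_graph_of G (DL m.+2 T).
Proof.
have [Phi [[Psi PhiK PsiK] act]] := Gamma_orbit.
have [par [adjE horoT]] := hom_tree_horotree T.
have [S0 S0P] := DL_locally_finite (Phi 1%g).
pose S := [seq g <- [seq Psi z | z <- S0] | adj (Phi 1%g) (Phi g)].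
have SE (g : G) : (g \in S) = adj (Phi 1%g) (Phi g).
  rewrite mem_filter andb_idr // => /S0P g0.
  by apply/mapP; exists (Phi g).
have adjG (x y : G) : ((x^-1 * y)%g \in S) = adj (Phi x) (Phi y).
  by rewrite SE -(act x) mulg1 mulVKg.
exists S; split.
- move=> x; rewrite !SE -(act x) mulg1 mulgV.
  exact: (DL_adjC adjE).
- have gen n (g : G) (z : DL m.+2 T) : walk (Phi g) z n ->
      exists2 w : seq G, {subset w <= S} & Psi z = (g * \prod_(y <- w) y)%g.
    elim: n g => [|n IHn] g.
      case=> -[|u p] [//= _ <- _]; exists [::] => //.
      by rewrite big_nil mulg1 PhiK.
    case/walkS => u gu; rewrite -[u]PsiK => /IHn[w wS ->].
    exists ((g^-1 * Psi u)%g :: w); last by rewrite big_cons mulgA mulVKg.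
    move=> y; rewrite inE => /predU1P[->|/wS //].
    by rewrite adjG PsiK.
  move=> x; have [n w] := DL_connected q_gt0 adjE horoT (isT : (1 < m.+2)%N) (Phi 1%g) (Phi x).
  have [s sS] := gen n 1%g (Phi x) w.
  by rewrite PhiK mul1g; exists s.
- exists Psi; split; first by exists Phi.
  by move=> x y; rewrite /= adjG !PsiK.
Qed.

End Cayley.

(** * The size of the prime powers *)

(** The prime [p i] divides [q], hence [p i ^ s] divides [q ^ s], and it is coprime
    to the other factors. *)
Lemma prime_power_factor_large (q s r : nat) (P : 'I_r -> nat) :
  (0 < q)%N -> prime_power_factorization (q ^ s) P -> forall i, (s < P i)%N.
Proof.
move=> q_gt0 [QE [p [e [p_inj pP]]]] i.
have [p_prime e_gt0 PE] := pP i.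
case: s QE => [|s] QE; first by rewrite PE expn_gt0 prime_gt0.
have p_dvd_q : p i %| q.
  suff : p i %| q ^ s.+1 by rewrite Euclid_dvdX // andbT.
  by rewrite QE (bigD1 i) //= PE dvdn_mulr // dvdn_exp.
have co : coprime (p i ^ s.+1) (\prod_(j < r | j != i) P j)%N.
  rewrite coprimeXl // coprime_sym; apply: (big_ind (fun n => coprime n (p i))).
  - exact: coprime1n.
  - by move=> a b ca cb; rewrite coprimeMl ca.
  - move=> j ji; have [pj_prime _ ->] := pP j.
    rewrite coprimeXl // prime_coprime // dvdn_prime2 //.
    by apply: contra ji => /eqP/p_inj->.
have dvd : p i ^ s.+1 %| P i.
  have QEi : q ^ s.+1 = (P i * \prod_(j < r | j != i) P j)%N by rewrite QE (bigD1 i).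
  by rewrite -(Gauss_dvdl _ co) -QEi dvdn_exp2r.
have P_gt0 : (0 < P i)%N by rewrite PE expn_gt0 prime_gt0.
apply: leq_trans (dvdn_leq P_gt0 dvd).
exact: (ltn_expl _ (prime_gt1 p_prime)).
Qed.

Lemma card_prod_field (r : nat) (F : 'I_r.+1 -> finFieldType) :
  #|{dffun forall i : 'I_r.+1, F i}| = (\prod_i #|F i|)%N.
Proof.
by rewrite card_dep_ffun foldrE big_image.
Qed.

Unset Implicit Arguments.

Theorem mainTheorem8 (R : realType) (q d : nat) (hq : 2 <= q) (hd : 2 <= d) :
  (forall s : nat, 1 <= s ->
     forall (T : hom_tree q) (T' : hom_tree (q ^ s)),
       quasi_isometric (@edist R (DL d T)) (@edist R (DL d T')))
  /\
  (exists s0 : nat, forall s : nat, s0 <= s ->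
     forall (r : nat) (P : 'I_r.+1 -> nat),
       prime_power_factorization (q ^ s) P ->
       (forall i, d.-1 <= P i) /\
       forall (F : 'I_r.+1 -> finFieldType), (forall i, #|F i| = P i) ->
       forall (l : forall i, 'I_d.-1 -> F i), (forall i, injective (l i)) ->
       forall (Rd : localization (t_plus_ell l)) (T : hom_tree (q ^ s)),
         is_cayley_graph_of (Gamma Rd) (DL d T)).
Proof.
split=> [s s_gt0 T T'|]; first exact: DL_quasi_isometric (ltnW hq) s_gt0 hd.
exists d => s ds r P PQ; have q_gt0 : 0 < q ^ s by rewrite expn_gt0 (ltnW hq).
split=> [i|F FP l l_inj Rd T].
  have := prime_power_factor_large (ltnW hq) PQ i => /ltnW; apply: leq_trans.
  exact: leq_trans (leq_pred d) ds.
have card_Q : #|{dffun forall i : 'I_r.+1, F i}| = q ^ s.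
  by rewrite card_prod_field; case: PQ => -> _; apply: eq_bigr.
case: d hd l l_inj Rd {ds} => [|[|m]] // _ l l_inj Rd.
exact: (@DL_cayley r F m l Rd l_inj (q ^ s) T q_gt0 card_Q).
Qed.
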